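(* Let $\phi:[c]^v\to\mathbb R$ be an arbitrary function and let $\{\mathcal G_n^{(v)}\}_{n\ge1}$ be the sequence of scaled Erdős–Rényi $v$-uniform random hypergraph tensors with parameter $p_n$ (defined in the context). Assume $n^{1-v}\ll p_n$. Then the following hold. (i) Let $\mathbf X=(X_1,\ldots,X_n)$ with $X_i$ i.i.d. from $\mu$, independent of $\mathcal G_n^{(v)}$. Then $N_n(\mathcal G_n^{(v)},\phi,\mathbf X)$ satisfies a conditional LDP (conditionally on $\mathcal G_n^{(v)}$) with speed $n$ and the good rate function $$J_{\mathbb 1}(t)=\inf_{\boldsymbol f\in\mathcal F_c:\ G_{\mathbb 1,\phi}(\boldsymbol f)=t}\left\{\int_0^1\sum_{r=1}^c f_r(u)\log\frac{f_r(u)}{\mu_r}\,du\right\},$$ where $\mathbb 1$ denotes the function identically equal to $1$ on $[0,1]^v$. (ii) For any $\beta\in\mathbb R$, $$Z_{\mathcal G_n^{(v)}}(\beta,\mu)\xrightarrow[n\to\infty]{\mathbb P}\sup_{\boldsymbol f\in\mathcal F_c}\left\{\beta\,G_{\mathbb 1,\phi}(\boldsymbol f)-\int_0^1\sum_{r=1}^c f_r(u)\log\frac{f_r(u)}{\mu_r}\,du\right\}.$$ Moreover, the supremum on the right-hand side is attained.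
   Context: Integers $c,v\ge2$ are fixed, $[m]:=\{1,\ldots,m\}$, and $\mu$ is a probability measure on $[c]$ with $\mu_r:=\mu(\{r\})>0$ for all $r\in[c]$. Notation $a_n\ll b_n$ means $a_n/b_n\to0$. Hypergraph tensor: for $p_n\in(0,1]$, independently over unordered $v$-subsets $\{i_1,\ldots,i_v\}$ of $[n]$, $\mathcal G_n^{(v)}(i_1,\ldots,i_v)=1/p_n$ with probability $p_n$ and $0$ with probability $1-p_n$; this value is extended symmetrically to all permutations of $(i_1,\ldots,i_v)$, and $\mathcal G_n^{(v)}(i_1,\ldots,i_v)=0$ if $i_1,\ldots,i_v$ are not all distinct. For a tensor $Q_n:[n]^v\to\mathbb R$, $$N_n(Q_n,\phi,\mathbf X):=\frac1{n^v}\sum_{i_1,\ldots,i_v=1}^n Q_n(i_1,\ldots,i_v)\,\phi(X_{i_1},\ldots,X_{i_v}),\qquad Z_{Q_n}(\beta,\mu):=\frac1n\log\mathbb E_{\mu^{\otimes n}}\exp\big(n\beta N_n(Q_n,\phi,\mathbf X)\big),$$ where in $Z$ the expectation is over $\mathbf X\sim\mu^{\otimes n}$ only, with $Q_n$ held fixed. $\mathcal F_c$ is the set of measurable $\boldsymbol f=(f_1,\ldots,f_c):[0,1]\to[0,1]^c$ with $\sum_{r=1}^c f_r(x)=1$ for all $x$ (modulo a.e. equality), and for symmetric $W\in L^1([0,1]^v)$, $$G_{W,\phi}(\boldsymbol f):=\int_{[0,1]^v}W(x_1,\ldots,x_v)\sum_{r_1,\ldots,r_v\in[c]}\phi(r_1,\ldots,r_v)\prod_{a=1}^v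 f_{r_a}(x_a)\,dx_1\cdots dx_v.$$ Conditional LDP: for random tensors $Q_n$, $N_n(Q_n,\phi,\mathbf X)$ satisfies a conditional LDP with speed $n$ and deterministic good rate function $J:\mathbb R\to[0,\infty]$ if the level sets of $J$ are compact and, for every Borel set $F\subseteq\mathbb R$ and every $\varepsilon>0$, $$\mathbb P_{Q_n}\left(-\inf_{x\in F^\circ}J(x)-\varepsilon\le\frac1n\log\mathbb P\big(N_n(Q_n,\phi,\mathbf X)\in F\mid Q_n\big)\le-\inf_{x\in\overline F}J(x)+\varepsilon\right)\xrightarrow{n\to\infty}1,$$ where $\mathbb P_{Q_n}$ is the probability over the randomness of $Q_n$. Conventions: $0\log0=0$, $\inf\emptyset=+\infty$. *)

(* Defs.v *)
From HB Require Import structures.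
From mathcomp Require Import all_boot all_order all_algebra.
From mathcomp Require Import all_classical all_reals all_analysis.

Set Implicit Arguments.
Unset Strict Implicit.
Unset Printing Implicit Defensive.

Import Order.TTheory GRing.Theory Num.Theory.
Import numFieldNormedType.Exports.

Local Open Scope classical_set_scope.
Local Open Scope ring_scope.

(* Here [m] = {1, ..., m} is 'I_m; a tuple (i_1, ..., i_v) of [n]^v is i : {ffun 'I_v -> 'I_n}. *)
Definition tensor (R : realType) (v n : nat) := {ffun 'I_v -> 'I_n} -> R.

Section tensors.
Context (R : realType) (v c n : nat).
Implicit Types (Q : tensor R v n) (phi : {ffun 'I_v -> 'I_c} -> R).
Implicit Types (mu : 'I_c -> R) (x : {ffun 'I_n -> 'I_c}).

Definition tensor_avg Q phi x : R :=
  (n%:R ^+ v)^-1 * \sum_(i : {ffun 'I_v -> 'I_n}) Q i * phi [ffun a => x (i a)].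

Definition product_weight mu x : R := \prod_(i < n) mu (x i).

Definition product_expectation mu (g : {ffun 'I_n -> 'I_c} -> R) : R :=
  \sum_(x : {ffun 'I_n -> 'I_c}) product_weight mu x * g x.

Definition log_partition phi mu (beta : R) Q : R :=
  n%:R^-1 * ln (product_expectation mu
    (fun x => expR (n%:R * beta * tensor_avg Q phi x))).

End tensors.

Section randomness.
Context d (T : measurableType d) (R : realType) (P : probability T R).

(* The product rule for a whole finite family gives the one for every
   subfamily, taking B i := setT outside of it. *)
Definition mutually_independent (I : finType) (D : pred I)
    (Y : I -> {RV P >-> R}) : Prop :=
  forall B : I -> set R, (forall i, measurable (B i)) ->
    P [set w | forall i, D i -> B i (Y i w)] =
    (\prod_(i | D i) P [set w | B i (Y i w)])%E.

(* xi e is the value carried by the v-subset e; its values at sets e with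
   #|e| != v are irrelevant. *)
Definition ER_hypergraph_tensor (v n : nat) (p : R) (Q : T -> tensor R v n) :
    Prop :=
  exists xi : {set 'I_n} -> {RV P >-> R},
    [/\ forall e : {set 'I_n}, #|e| = v ->
          P [set w | xi e w = p^-1] = p%:E /\
          P [set w | xi e w = 0] = (1 - p)%:E,
        mutually_independent (fun e : {set 'I_n} => #|e| == v) xi
      & forall w i,
          Q w i = if injectiveb i then xi [set i a | a : 'I_v]%SET w else 0].

Definition iid_colours (c n : nat) (mu : 'I_c -> R)
    (X : T -> {ffun 'I_n -> 'I_c}) : Prop :=
  forall x, measurable [set w | X w = x] /\
    P [set w | X w = x] = (product_weight mu x)%:E.

Definition colours_independent_of_tensor (v c n : nat)
    (X : T -> {ffun 'I_n -> 'I_c}) (Q : T -> tensor R v n) : Prop :=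
  forall (x : {ffun 'I_n -> 'I_c}) (B : {ffun 'I_v -> 'I_n} -> set R),
    (forall i, measurable (B i)) ->
    P ([set w | X w = x] `&` [set w | forall i, B i (Q w i)]) =
    (P [set w | X w = x] * P [set w | forall i, B i (Q w i)])%E.

(* Elementary conditional probability P(E | Q)(w) = P(E, Q = Q w) / P(Q = Q w).
   This is a version of the conditional probability only for an (almost surely)
   discrete Q, as the hypergraph tensor is; it is 0 when P(Q = Q w) = 0. *)
Definition cond_prob (S : Type) (Q : T -> S) (E : set T) (w : T) : R :=
  fine (P (E `&` [set w' | Q w' = Q w])) / fine (P [set w' | Q w' = Q w]).

Definition good_rate_function (J : R -> \bar R) : Prop :=
  (forall t, (0 <= J t)%E) /\
  (forall a : R, compact [set t | (J t <= a%:E)%E]).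

(* [lne] is the extended logarithm, with value -oo at 0. *)
Definition conditional_LDP (S : nat -> Type) (Q : forall n, T -> S n)
    (N : nat -> T -> R) (J : R -> \bar R) : Prop :=
  good_rate_function J /\
  forall F : set R, measurable F -> forall eps : R, 0 < eps ->
    P [set w |
        (- ereal_inf (J @` interior F) - eps%:E <=
           (n%:R^-1)%:E * lne (cond_prob (Q n) (N n @^-1` F) w)%:E)%E /\
        ((n%:R^-1)%:E * lne (cond_prob (Q n) (N n @^-1` F) w)%:E <=
           - ereal_inf (J @` closure F) + eps%:E)%E]
      @[n --> \oo] --> 1%E.

Definition cvg_in_probability (Y : nat -> T -> R) (l : \bar R) : Prop :=
  forall eps : R, 0 < eps ->
    P [set w | (eps%:E <= `|(Y n w)%:E - l|)%E] @[n --> \oo] --> 0%E.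

End randomness.

Section graphon_functionals.
Context (R : realType).

Section cons_product.
Context (n : nat).
Variable m : {sigma_finite_measure set (n.-tuple (measurableTypeR R)) -> \bar R}.

Definition tuple_of_pair (z : measurableTypeR R * n.-tuple (measurableTypeR R)) :
  n.+1.-tuple (measurableTypeR R) := [tuple of z.1 :: z.2].

Definition cons_product :
    set (n.+1.-tuple (measurableTypeR R)) -> \bar R :=
  pushforward (@lebesgue_measure R \x m)%E tuple_of_pair.

Let measurable_tuple_of_pair : measurable_fun setT tuple_of_pair.
Proof. exact: measurable_cons measurable_fst measurable_snd. Qed.

Let cons_product0 : cons_product set0 = 0%E.
Proof. by rewrite /cons_product /pushforward preimage_set0 measure0. Qed.

Let cons_product_ge0 A : (0 <= cons_product A)%E.
Proof. exact: measure_ge0. Qed.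

Let cons_product_sigma_additive : semi_sigma_additive cons_product.
Proof.
have mpre A : measurable A -> measurable (tuple_of_pair @^-1` A).
  by move=> mA; rewrite -[X in measurable X]setTI; exact: measurable_tuple_of_pair.
move=> F mF tF mUF; rewrite /cons_product /pushforward preimage_bigcup.
apply: measure_semi_sigma_additive.
- by move=> n0; exact: mpre.
- by move=> i j _ _ [z [Fi Fj]]; apply: (tF i j) => //; exists (tuple_of_pair z).
- by rewrite -preimage_bigcup; exact: mpre.
Qed.

HB.instance Definition _ := isMeasure.Build _ _ _ cons_product
  cons_product0 cons_product_ge0 cons_product_sigma_additive.

Let cons_product_sigma_finite : sigma_finite setT cons_product.
Proof.
have /sigma_finiteP[F [FT ndF Foo]] := sigma_finiteT (@lebesgue_measure R).
have /sigma_finiteP[K [KT ndK Koo]] := sigma_finiteT m.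
pose tl (x : n.+1.-tuple (measurableTypeR R)) := [tuple of behead x].
exists (fun k => (@thead _ _) @^-1` F k `&` tl @^-1` K k).
  rewrite predeqE => x; split=> // _.
  have [i _ Fi] : (\bigcup_i F i) (thead x) by rewrite -FT.
  have [j _ Kj] : (\bigcup_j K j) (tl x) by rewrite -KT.
  exists (maxn i j) => //; split.
    by have /subsetPset := ndF _ _ (leq_maxl i j); apply.
  by have /subsetPset := ndK _ _ (leq_maxr i j); apply.
move=> k; have [mF Fk] := Foo k; have [mK Kk] := Koo k; split.
  apply: measurableI; rewrite -[X in measurable X]setTI.
    exact: (measurable_tnth ord0).
  exact: measurable_behead.
rewrite /cons_product /pushforward (_ : _ @^-1` _ = F k `*` K k).
  by rewrite product_measure1E// lte_mul_pinfty// ge0_fin_numE.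
apply/seteqP; split=> -[x y] /=; rewrite theadE (_ : tl _ = y)//;
  exact: val_inj.
Qed.

HB.instance Definition _ := Measure_isSigmaFinite.Build _ _ _ cons_product
  cons_product_sigma_finite.

End cons_product.

(* Lebesgue measure on R^v, as the v-fold product of [lebesgue_measure]. *)
Fixpoint lebesgue_tuple (v : nat) :
    {sigma_finite_measure set (v.-tuple (measurableTypeR R)) -> \bar R} :=
  match v with
  | 0 => dirac [tuple]
  | n.+1 => cons_product (lebesgue_tuple n)
  end.

Definition unit_cube (v : nat) : set (v.-tuple (measurableTypeR R)) :=
  [set x | forall a, 0 <= tnth x a <= 1].

Definition fractional_colourings (c : nat) : set ('I_c -> R -> R) :=
  [set f | [/\ forall r, measurable_fun (`[0, 1] : set (measurableTypeR R))
                           (f r : _ -> measurableTypeR R),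
               forall r x, 0 <= x <= 1 -> 0 <= f r x <= 1
             & forall x, 0 <= x <= 1 -> \sum_(r < c) f r x = 1]].

Definition graphon_functional (v c : nat)
    (W : v.-tuple (measurableTypeR R) -> R) (phi : {ffun 'I_v -> 'I_c} -> R)
    (f : 'I_c -> R -> R) : R :=
  \int[lebesgue_tuple v]_(x in @unit_cube v)
    (W x * \sum_(r : {ffun 'I_v -> 'I_c})
             phi r * \prod_(a < v) f (r a) (tnth x a)).

(* 0 log 0 = 0 holds since [ln 0 = 0]. *)
Definition relative_entropy (c : nat) (mu : 'I_c -> R) (f : 'I_c -> R -> R) :
    \bar R :=
  (\int[@lebesgue_measure R]_(u in `[0%R, 1%R])
     (\sum_(r < c) f r u * ln (f r u / mu r))%:E)%E.

Definition rate_one (v c : nat) (phi : {ffun 'I_v -> 'I_c} -> R)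
    (mu : 'I_c -> R) (t : R) : \bar R :=
  ereal_inf [set relative_entropy mu f | f in
    [set f | @fractional_colourings c f /\
             graphon_functional (fun=> 1) phi f = t]].

Definition free_energy (v c : nat) (phi : {ffun 'I_v -> 'I_c} -> R)
    (mu : 'I_c -> R) (beta : R) (f : 'I_c -> R -> R) : \bar R :=
  ((beta * graphon_functional (fun=> 1%R) phi f)%:E - relative_entropy mu f)%E.

End graphon_functionals.

(* Main.v *)
Require Import Defs.
From HB Require Import structures.
From mathcomp Require Import all_boot all_order all_algebra.
From mathcomp Require Import all_classical all_reals all_analysis.
From mathcomp Require Import measurable_realfun.
From mathcomp Require Import zify ring lra.
Import Order.TTheory GRing.Theory Num.Theory.
Import numFieldNormedType.Exports.
Local Open Scope classical_set_scope.
Local Open Scope ring_scope.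

Set Implicit Arguments.
Unset Strict Implicit.
Unset Printing Implicit Defensive.

(* Write h(q) for the value of G_{1,phi} at a constant colouring q of the
   simplex and H(q) for its relative entropy with respect to mu. By Fubini
   G_{1,phi}(f) = h(int f), and by convexity the entropy of f is at least
   H(int f), so all variational problems reduce to the compact simplex.

   For the tensor constantly equal to 1 the average is exactly h(L_x), with L_x
   the empirical law of x, and the method of types settles both claims. The
   Chernoff bound for a sum over the v-subsets of [n] is exp(- C n) for every C
   as soon as n^(1-v) << p_n; this beats the c^n colourings, so that with high
   probability |N_n(G_n, phi, x) - h(L_x)| <= del holds for all x at once. On
   this event the conditional law of N_n is that of h(L_X) up to del, and
   compactness of the simplex lets del tend to 0. *)

(** * Exponential bounds for finite product weights *)

Section finite_product_space.
Context (R : realType).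

(** Two sources of randomness have to be separated. Given the tensor, the law of the colours is a
    finite sum over [x], so the estimates for them are stated for an arbitrary deterministic [Q]
    uniformly close to the mean field, with [del] and the threshold on [n] independent of [Q]. The
    tensor then enters only through the probability of being close.

    The concentration lives on the scale rho = n^(1-v) / p_n. Tilting the centred edge variables by
    K n / n^v gives exponents of size O(K rho) and a total variance term n O(K^2 rho), against a
    gain n K del. As rho tends to 0, every constant K is allowed; taking it proportional to (c + 1)
    / del beats the c^n colourings.

    Two defects remain. The hypergraph tensor vanishes on tuples with repetitions, which is a bias
    of order 1 / n. And conditional probabilities are elementary quotients, meaningful only at
    tensor values of positive probability, so events are reduced to the finitely many tensors that
    come from edge configurations. *)

Lemma ln_ge_1subV (x : R) : 0 < x -> 1 - x^-1 <= ln x.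
Proof.
move=> x0; have : ln (1 + (x^-1 - 1)) <= x^-1 - 1.
  by apply: le_ln1Dx; rewrite ltrBrDl subrr invr_gt0.
by rewrite addrC subrK lnV ?posrE//; lra.
Qed.

(** Inverting [1 - y <= expR (- y)] reduces the claim to [y ^+ 2 * (1 - 2 * y) >= 0]. The bound is
    one-sided in [y], so it suits variables that are only bounded above. *)
Lemma expR_le_quadratic (y : R) : y <= 2^-1 -> expR y <= 1 + y + 2 * y ^+ 2.
Proof.
move=> y2; have y1 : 0 < 1 - y by lra.
rewrite -[expR y]invrK -expRN; apply: (@le_trans _ _ (1 - y)^-1).
  by rewrite lef_pV2 ?posrE ?expR_gt0// expR_ge1Dx.
rewrite -(@ler_pM2r _ (1 - y))// mulVf ?gt_eqF//.
have : 0 <= y ^+ 2 * (1 - 2 * y) by rewrite mulr_ge0 ?sqr_ge0//; lra.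
nra.
Qed.

(** Markov's inequality for the exponential; distributing the product over the sum plays the role of
    independence. It serves both the vertex colours and the edge variables. *)
Lemma product_chernoff (I V : finType) (w g : I -> V -> R) (b : I -> R) (a : R) :
  (forall i u, 0 <= w i u) ->
  (forall i, \sum_u w i u * expR (g i u) <= expR (b i)) ->
  \sum_(x : {ffun I -> V} | a <= \sum_i g i (x i)) \prod_i w i (x i) <=
  expR (\sum_i b i - a).
Proof.
move=> w0 Hb.
apply: (@le_trans _ _ (\sum_(x : {ffun I -> V})
   (\prod_i w i (x i)) * expR (\sum_i g i (x i) - a))).
  rewrite big_mkcond/=; apply: ler_sum => x _.
  have P0 : 0 <= \prod_i w i (x i) by apply: prodr_ge0.
  case: ifP => [ax|_]; last by rewrite mulr_ge0// expR_ge0.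
  by rewrite ler_peMr// -expR0 ler_expR subr_ge0.
rewrite (eq_bigr (fun x : {ffun I -> V} =>
   (\prod_i (w i (x i) * expR (g i (x i)))) * expR (- a))); last first.
  by move=> x _; rewrite big_split/= expRD expR_sum mulrA.
rewrite -mulr_suml expRD ler_wpM2r ?expR_ge0//.
rewrite -(bigA_distr_bigA (fun i u => w i u * expR (g i u))) expR_sum.
apply: ler_prod => i _; rewrite Hb andbT.
by apply: sumr_ge0 => u _; rewrite mulr_ge0// expR_ge0.
Qed.

(** Centring removes the linear term of the quadratic bound, and only the second moment is left. *)
Lemma mgf_le_expR_variance (V : finType) (w g : V -> R) :
  (forall u, 0 <= w u) -> \sum_u w u = 1 -> \sum_u w u * g u = 0 ->
  (forall u, g u <= 2^-1) ->
  \sum_u w u * expR (g u) <= expR (2 * \sum_u w u * g u ^+ 2).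
Proof.
move=> w0 w1 wg g1.
apply: (@le_trans _ _ (\sum_u (w u + w u * g u + 2 * (w u * g u ^+ 2)))).
  apply: ler_sum => u _.
  rewrite mulrCA -[X in X + _ + _]mulr1 -!mulrDr.
  by apply: ler_wpM2l => //; exact: expR_le_quadratic.
rewrite !big_split/= w1 wg addr0 -mulr_sumr; exact: expR_ge1Dx.
Qed.

Lemma sum_prod_weights (I V : finType) (w : I -> V -> R) :
  (forall i, \sum_u w i u = 1) ->
  \sum_(x : {ffun I -> V}) \prod_i w i (x i) = 1.
Proof. by move=> w1; rewrite -bigA_distr_bigA big1. Qed.

End finite_product_space.

(** * The empirical law *)

Section empirical_law.
Context (R : realType) (c : nat).
Implicit Types (q mu g : 'I_c -> R).

Definition prob_vector q : Prop := (forall r, 0 <= q r) /\ \sum_r q r = 1.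

Definition mean_field v (phi : {ffun 'I_v -> 'I_c} -> R) q : R :=
  \sum_(r : {ffun 'I_v -> 'I_c}) phi r * \prod_a q (r a).

Definition discrete_entropy mu q : R := \sum_r q r * ln (q r / mu r).

Definition empirical n (x : {ffun 'I_n -> 'I_c}) (r : 'I_c) : R :=
  n%:R^-1 * \sum_(i < n) (x i == r)%:R.

Lemma prob_vector_le1 q r : prob_vector q -> q r <= 1.
Proof.
by move=> [q0 <-]; rewrite (bigD1 r)//= lerDl sumr_ge0.
Qed.

Lemma prob_vector_empirical n (x : {ffun 'I_n -> 'I_c}) :
  (0 < n)%N -> prob_vector (empirical x).
Proof.
move=> n0; split=> [r|]; first by rewrite mulr_ge0// sumr_ge0.
rewrite -mulr_sumr exchange_big/= (eq_bigr (fun=> 1)) => [|i _].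
  by rewrite sumr_const card_ord mulVf// pnatr_eq0 -lt0n.
by rewrite (bigD1 (x i))//= eqxx big1 ?addr0// => r /negPf; rewrite eq_sym => ->.
Qed.

Lemma sum_empirical n (x : {ffun 'I_n -> 'I_c}) g :
  (0 < n)%N -> \sum_i g (x i) = n%:R * \sum_r empirical x r * g r.
Proof.
move=> n0; rewrite mulr_sumr.
under [RHS]eq_bigr => r _.
  rewrite /empirical !mulrA mulfV ?pnatr_eq0 -?lt0n// mul1r mulr_suml; over.
rewrite exchange_big/=; apply: eq_bigr => i _.
rewrite (bigD1 (x i))//= eqxx mul1r big1 ?addr0// => r /negPf.
by rewrite eq_sym => ->; rewrite mul0r.
Qed.

(** Expanding the product of [v] empirical frequencies sums over all index tuples, repetitions
    included, and for each tuple only [r = x \o i] survives. The identity is therefore exact for the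
    constant tensor, diagonal entries included. *)
Lemma tensor_avg1 v n (phi : {ffun 'I_v -> 'I_c} -> R)
    (x : {ffun 'I_n -> 'I_c}) :
  tensor_avg (fun=> 1) phi x = mean_field phi (empirical x).
Proof.
rewrite /tensor_avg /mean_field /empirical.
under [RHS]eq_bigr => r _.
  rewrite big_split/= prodr_const card_ord bigA_distr_bigA/= mulrCA; over.
rewrite -[RHS]mulr_sumr exprVn; congr (_ * _).
under [RHS]eq_bigr do rewrite mulr_sumr.
rewrite exchange_big/=; apply: eq_bigr => i _; rewrite mul1r.
rewrite (bigD1 [ffun a => x (i a)])//= big1 ?mulr1; last first.
  by move=> a _; rewrite ffunE eqxx.
rewrite big1 ?addr0// => r rx.
have [a xa] : exists a, x (i a) != r a.
  apply/existsP; rewrite -negb_forall; apply: contra rx => /forallP xr.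
  by apply/eqP/ffunP => a; rewrite ffunE (eqP (xr a)).
by rewrite (bigD1 a)//= (negPf xa) mul0r mulr0.
Qed.

Lemma product_weight_ge0 mu n (x : {ffun 'I_n -> 'I_c}) :
  (forall r, 0 <= mu r) -> 0 <= product_weight mu x.
Proof. by move=> mu0; apply: prodr_ge0. Qed.

Lemma sum_product_weight mu n : prob_vector mu ->
  \sum_(x : {ffun 'I_n -> 'I_c}) product_weight mu x = 1.
Proof. by move=> [_ mu1]; apply: (@sum_prod_weights R 'I_n 'I_c (fun=> mu)). Qed.

(** Change of measure: the likelihood ratio is a product over vertices, so it depends on [x] only
    through its empirical law. *)
Lemma product_weight_tilt mu q n (x : {ffun 'I_n -> 'I_c}) :
  (0 < n)%N -> (forall r, 0 < mu r) -> (forall i, 0 < q (x i)) ->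
  product_weight mu x =
  product_weight q x * expR (- (n%:R * \sum_r empirical x r * ln (q r / mu r))).
Proof.
move=> n0 mu0 q0; rewrite -(sum_empirical _ (fun r => ln (q r / mu r)))//.
rewrite -sumrN expR_sum -big_split/=; apply: eq_bigr => i _.
rewrite expRN lnK ?posrE ?divr_gt0// invf_div mulrCA mulfV ?mulr1//.
by rewrite gt_eqF.
Qed.

(* If q (x i) = 0 for some i, the left-hand side is 0, so the junk value
   ln 0 = 0 is harmless. *)
Lemma product_weight_tilt_ge mu q n (x : {ffun 'I_n -> 'I_c}) :
  (0 < n)%N -> (forall r, 0 < mu r) -> (forall r, 0 <= q r) ->
  product_weight q x * expR (- (n%:R * \sum_r empirical x r * ln (q r / mu r)))
  <= product_weight mu x.
Proof.
move=> n0 mu0 q0.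
have [qx|/existsP[i qx]] := boolP [forall i, 0 < q (x i)].
  by rewrite (product_weight_tilt (q := q) n0 mu0)//; exact/forallP.
have -> : product_weight q x = 0.
  rewrite /product_weight (bigD1 i)//=.
  have -> : q (x i) = 0 by apply/eqP; rewrite eq_le q0 andbT leNgt.
  by rewrite mul0r.
by rewrite mul0r product_weight_ge0// => r; apply: ltW.
Qed.

(** Tilting by the law of [x] itself, which charges every colour occurring in [x], so that the exact
    change of measure applies. *)
Lemma product_weight_empirical mu n (x : {ffun 'I_n -> 'I_c}) :
  (0 < n)%N -> (forall r, 0 < mu r) ->
  product_weight mu x = product_weight (empirical x) x *
    expR (- (n%:R * discrete_entropy mu (empirical x))).
Proof.
move=> n0 mu0; rewrite {1}(product_weight_tilt (q := empirical x) n0 mu0)// => i.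
rewrite mulr_gt0 ?invr_gt0 ?ltr0n// (bigD1 i)//= eqxx.
by rewrite ltr_pwDl// sumr_ge0.
Qed.

(* Method of types: L_x is one of at most (n + 1)^c laws, and the product weights
   of each law sum to 1. *)
Lemma sum_product_weight_empirical n : (0 < n)%N ->
  \sum_(x : {ffun 'I_n -> 'I_c}) product_weight (empirical x) x <=
  n.+1%:R ^+ c.
Proof.
move=> n0.
pose k (t : {ffun 'I_c -> 'I_n.+1}) (r : 'I_c) : R := n%:R^-1 * (t r)%:R.
have k0 t r : 0 <= k t r by rewrite mulr_ge0.
have [P PE] : exists P : pred {ffun 'I_c -> 'I_n.+1},
    forall t, P t <-> prob_vector (k t).
  by exists (fun t => `[< prob_vector (k t) >]) => t; split=> /asboolP.
(* The sum is enlarged to all laws with denominator [n]; the term of [x] is recovered at its own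
   colour counts, and for each admissible law the inner sum is 1. *)
apply: (@le_trans _ _ (\sum_(t | P t) \sum_x product_weight (n := n) (k t) x)).
  rewrite exchange_big/=; apply: ler_sum => x _.
  pose t : {ffun 'I_c -> 'I_n.+1} := [ffun r => inord (\sum_(i < n) (x i == r))].
  have kt : k t = empirical x.
    apply/funext => r; rewrite /k /empirical -natr_sum ffunE inordK// ltnS.
    rewrite -[leqRHS]card_ord -sum1_card; apply: leq_sum => i _.
    by case: eqP.
  have Pt : P t by apply/PE; rewrite kt; exact: prob_vector_empirical.
  rewrite (bigD1 t)//= kt lerDl sumr_ge0// => s _.
  exact: product_weight_ge0.
rewrite (eq_bigr (fun=> 1)) => [|t /PE]; last exact: sum_product_weight.
rewrite sumr_const -natrX ler_nat (leq_trans (max_card _))//.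
by rewrite card_ffun !card_ord.
Qed.

(** After tilting each [x] by its own law, the exponent is [n] times [g - discrete_entropy mu] at
    that law, hence at most [n * s] on [B]; the remaining weights have polynomial total mass. *)
Lemma laplace_upper_bound mu n (g : ('I_c -> R) -> R) (B : set ('I_c -> R))
    (s : R) :
  (0 < n)%N -> (forall r, 0 < mu r) ->
  (forall q, prob_vector q -> B q -> g q - discrete_entropy mu q <= s) ->
  \sum_(x : {ffun 'I_n -> 'I_c} | `[< B (empirical x) >])
    product_weight mu x * expR (n%:R * g (empirical x)) <=
  n.+1%:R ^+ c * expR (n%:R * s).
Proof.
move=> n0 mu0 gs.
apply: le_trans (ler_wpM2r (expR_ge0 _) (sum_product_weight_empirical n0)).
rewrite big_mkcond/= mulr_suml; apply: ler_sum => x _.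
have e0 : 0 <= product_weight (empirical x) x.
  by apply: product_weight_ge0; case: (prob_vector_empirical x n0).
case: ifPn => [/asboolP Bx|_]; last by rewrite mulr_ge0 ?expR_ge0.
rewrite (product_weight_empirical _ n0 mu0) -mulrA -expRD ler_wpM2l//.
rewrite ler_expR addrC -mulrBr ler_wpM2l//; apply: gs => //.
exact: prob_vector_empirical.
Qed.

(** The Chernoff bound with tilt [eta / 4]: each vertex costs at most
    [2 * (eta / 4) ^+ 2 = eta ^+ 2 / 8] against a gain of [eta ^+ 2 / 4]. The sign [sg] covers both
    tails, whence the factor 2. *)
Lemma empirical_tail q (r : 'I_c) n (eta : R) : (0 < n)%N -> prob_vector q ->
  0 < eta <= 1 ->
  \sum_(x : {ffun 'I_n -> 'I_c} | eta < `|empirical x r - q r|)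
    product_weight q x <= 2 * expR (- (n%:R * (eta ^+ 2 / 8))).
Proof.
move=> n0 qP /andP[eta0 eta1]; have [q0 q1] := qP.
have qr1 := prob_vector_le1 r qP.
have side (sg : R) : `|sg| = 1 ->
    \sum_(x : {ffun 'I_n -> 'I_c} |
      n%:R * (eta ^+ 2 / 4) <=
        \sum_i (eta / 4) * (sg * ((x i == r)%:R - q r)))
      product_weight q x <= expR (- (n%:R * (eta ^+ 2 / 8))).
  move=> sg1.
  pose g (_ : 'I_n) (u : 'I_c) := (eta / 4) * (sg * ((u == r)%:R - q r)).
  have gs u : `|sg * ((u == r)%:R - q r)| <= 1.
    rewrite normrM sg1 mul1r ler_norml; have := q0 r.
    by case: (u == r) => /= ?; rewrite ?mulr1n ?mulr0n; lra.
  have := @product_chernoff R 'I_n 'I_c (fun=> q) g (fun=> eta ^+ 2 / 8)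
    (n%:R * (eta ^+ 2 / 4)).
  have -> : expR (\sum_(i < n) eta ^+ 2 / 8 - n%:R * (eta ^+ 2 / 4)) =
            expR (- (n%:R * (eta ^+ 2 / 8))).
    by rewrite sumr_const card_ord -mulr_natl; congr expR; field.
  apply => // i.
  apply: (@le_trans _ _ (expR (2 * \sum_u q u * g i u ^+ 2))).
    apply: mgf_le_expR_variance => // [|u].
      rewrite /g.
      under eq_bigr => u _ do rewrite mulrCA [q u * _]mulrCA.
      rewrite -!mulr_sumr.
      under eq_bigr => u _ do rewrite mulrBr.
      rewrite sumrB (bigD1 r)//= eqxx mulr1 big1 ?addr0; last first.
        by move=> u /negPf ->; rewrite mulr0.
      by rewrite -mulr_suml q1 mul1r subrr !mulr0.
    rewrite /g (le_trans (ler_norm _))// normrM gtr0_norm ?divr_gt0//.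
    by have := gs u; have := normr_ge0 (sg * ((u == r)%:R - q r)); nra.
  rewrite ler_expR.
  apply: (@le_trans _ _ (2 * \sum_u q u * (eta ^+ 2 / 16))); last first.
    by rewrite -mulr_suml q1; lra.
  rewrite ler_wpM2l//; apply: ler_sum => u _; rewrite ler_wpM2l// /g exprMn.
  rewrite -[X in _ <= X]mulr1 (_ : (eta / 4) ^+ 2 = eta ^+ 2 / 16); last by field.
  by rewrite ler_wpM2l ?divr_ge0 ?sqr_ge0// -real_normK ?num_real// expr_le1.
have empE (x : {ffun 'I_n -> 'I_c}) (sg : R) :
    \sum_i (eta / 4) * (sg * ((x i == r)%:R - q r)) =
    (eta / 4) * (sg * (n%:R * (empirical x r - q r))).
  rewrite -!mulr_sumr sumrB sumr_const card_ord /empirical [n%:R * (_ - _)]mulrBr.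
  by rewrite [n%:R * (_ * _)]mulrA mulfV ?pnatr_eq0 -?lt0n// mul1r mulr_natl.
rewrite mulr_natl mulr2n.
apply: le_trans (lerD (side 1 (normr1 _)) (side (-1) (normrN1 _))).
rewrite [in leRHS]big_mkcond/= [X in _ <= _ + X]big_mkcond/= -big_split/=.
rewrite big_mkcond/=; apply: ler_sum => x _.
have w0 : 0 <= product_weight q x by exact: product_weight_ge0.
case: ifPn => [|_]; last by rewrite addr_ge0//; case: ifP.
rewrite !empE.
have n1 : (0 : R) < n%:R by rewrite ltr0n.
rewrite lter_normr => /orP[h|h].
  rewrite ifT ?lerDl; first by case: ifP.
  by have : n%:R * eta * eta <= n%:R * eta * (empirical x r - q r);
    [rewrite ler_wpM2l ?mulr_ge0 ?ltW|nra].
rewrite [X in _ + X]ifT ?lerDr; first by case: ifP.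
by have : n%:R * eta * eta <= n%:R * eta * - (empirical x r - q r);
  [rewrite ler_wpM2l ?mulr_ge0 ?ltW|nra].
Qed.

End empirical_law.

Arguments empirical {R c n} x r.

(** * Exponential asymptotics and the Laplace lower bound *)

Section asymptotics.
Context (R : realType) (c : nat).
Implicit Types (q mu : 'I_c -> R).

Lemma near_mul_expRN_le1 (K a : R) : 0 < a ->
  \forall n \near \oo, K * expR (- (n%:R * a)) <= 1.
Proof.
move=> a0; near=> n.
rewrite expRN -ler_pdivlMr ?invr_gt0 ?expR_gt0// invrK mul1r.
apply: le_trans (expR_ge1Dx _); rewrite -lerBlDl -ler_pdivrMr//.
by near: n; exact: nbhs_infty_ger.
Unshelve. all: by end_near. Qed.

(** It suffices that [n + 1 <= expR (n * b)] with [b = a / (k + 1)]. Squaring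
    [1 + n * b / 2 <= expR (n * b / 2)] yields a term [(n * b) ^+ 2 / 4], which is at least [2 * n]
    once [n >= 8 / b ^+ 2]. *)
Lemma near_polynomial_le_expR (k : nat) (a : R) : 0 < a ->
  \forall n \near \oo, n.+1%:R ^+ k <= expR (n%:R * a).
Proof.
move=> a0.
have b0 : 0 < a / (k.+1)%:R by rewrite divr_gt0.
set b := a / k.+1%:R in b0.
near=> n.
have n1 : 1 <= n%:R :> R by rewrite ler1n; near: n; exact: nbhs_infty_ge.
have nb : 8 / b ^+ 2 <= n%:R by near: n; exact: nbhs_infty_ger.
apply: (@le_trans _ _ (expR (n%:R * b) ^+ k)); last first.
  rewrite -expRM_natl ler_expR /b mulrCA ler_wpM2l// mulrCA ler_piMr ?(ltW a0)//.
  by rewrite ler_pdivrMr// mul1r ler_nat.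
rewrite lerXn2r ?nnegrE ?expR_ge0//.
rewrite (_ : n%:R * b = 2%:R * (n%:R * b / 2)); last by field.
rewrite expRM_natl; apply: (@le_trans _ _ ((1 + n%:R * b / 2) ^+ 2)).
  move: nb; rewrite ler_pdivrMr ?exprn_gt0// => nb; rewrite -natr1.
  have : 8 * n%:R <= n%:R * b ^+ 2 * n%:R by rewrite ler_wpM2r.
  have : 0 <= n%:R * b by rewrite mulr_ge0 ?(ltW b0).
  nra.
rewrite lerXn2r ?nnegrE ?expR_ge0//; 
  first by rewrite addr_ge0// divr_ge0// mulr_ge0// (ltW b0).
exact: expR_ge1Dx.
Unshelve. all: by end_near. Qed.

(** Under the tilted law [q] the colourings with empirical law near [q] keep at least half of the
    mass, and on them the cost of the tilt is close to the entropy of [q]. *)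
Lemma laplace_lower_bound mu q (eta : R) :
  (forall r, 0 < mu r) -> prob_vector q -> 0 < eta ->
  \forall n \near \oo, expR (- (n%:R * (discrete_entropy mu q + eta))) <=
    \sum_(x : {ffun 'I_n -> 'I_c} |
        [forall r, `|empirical x r - q r| <= eta]) product_weight mu x.
Proof.
move=> mu0 qP eta0; have [q0 q1] := qP.
pose L := \sum_r `|ln (q r / mu r)|.
have L0 : 0 <= L by apply: sumr_ge0.
(* A smaller radius than [eta]: it makes the tilt exponent deviate from the entropy by at most
   [e * L <= eta / 2], and [e <= 1] is required by the tail bound. *)
pose e := Num.min 1 (eta / (2 * (1 + L))).
have e0 : 0 < e by rewrite lt_min ltr01 divr_gt0// mulr_gt0//; lra.
have e1 : e <= 1 by rewrite ge_min lexx.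
have eL : 2 * (1 + L) * e <= eta.
  by rewrite mulrC -ler_pdivlMr ?ge_min ?lexx ?orbT// mulr_gt0//; lra.
have ee : e <= eta by nra.
near=> n.
have n0 : (0 < n)%N by near: n; exact: nbhs_infty_ge.
apply: (@le_trans _ _ (\sum_(x : {ffun 'I_n -> 'I_c} |
    [forall r, `|empirical x r - q r| <= e]) product_weight mu x)); last first.
  rewrite big_mkcond [leRHS]big_mkcond/=; apply: ler_sum => x _.
  have w0 : 0 <= product_weight mu x by apply: product_weight_ge0 => r; exact: ltW.
  case: ifPn => [/forallP xe|_]; last by case: ifP.
  by rewrite ifT//; apply/forallP => r; exact: le_trans (xe r) ee.
apply: (@le_trans _ _ (\sum_(x : {ffun 'I_n -> 'I_c} |
    [forall r, `|empirical x r - q r| <= e]) product_weight q x *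
    expR (- (n%:R * (discrete_entropy mu q + eta / 2))))); last first.
  apply: ler_sum => x /forallP xe.
  rewrite (le_trans _ (product_weight_tilt_ge x n0 mu0 q0))//.
  rewrite ler_wpM2l ?product_weight_ge0// ler_expR lerN2 ler_wpM2l//.
  rewrite -lerBlDl -sumrB.
  apply: (@le_trans _ _ (\sum_r e * `|ln (q r / mu r)|)).
    apply: ler_sum => r _; rewrite -mulrBl (le_trans (ler_norm _))// normrM.
    by rewrite ler_wpM2r.
  by rewrite -mulr_sumr -/L; nra.
rewrite -mulr_suml (_ : expR _ = expR (- (n%:R * (eta / 2))) *
    expR (- (n%:R * (discrete_entropy mu q + eta / 2)))); last first.
  by rewrite -expRD; congr expR; field.
rewrite ler_wpM2r ?expR_ge0//.
(* Union bound over the colours: the tails add up to at most 1/2, and [expR (- (n * (eta / 2)))] is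
   below the other half. *)
apply: (@le_trans _ _ (1 - \sum_(r < c) 2 * expR (- (n%:R * (e ^+ 2 / 8))))).
  rewrite sumr_const card_ord -[_ *+ c]mulr_natl.
  have h1 : 4 * c%:R * expR (- (n%:R * (e ^+ 2 / 8))) <= 1.
    by near: n; apply: near_mul_expRN_le1; rewrite divr_gt0 ?exprn_gt0.
  have h2 : 2 * expR (- (n%:R * (eta / 2))) <= 1.
    by near: n; apply: near_mul_expRN_le1; rewrite divr_gt0.
  nra.
rewrite lerBlDr -[leLHS](sum_product_weight n qP).
apply: (@le_trans _ _ (\sum_(x : {ffun 'I_n -> 'I_c} |
    [forall r, `|empirical x r - q r| <= e]) product_weight q x +
    \sum_r \sum_(x : {ffun 'I_n -> 'I_c} | e < `|empirical x r - q r|)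
       product_weight q x)); last first.
  by rewrite lerD2l; apply: ler_sum => r _; apply: empirical_tail; rewrite ?e0.
rewrite [X in _ <= X + _]big_mkcond/=.
under [X in _ <= _ + X]eq_bigr do rewrite big_mkcond/=.
rewrite exchange_big/= -big_split/=; apply: ler_sum => x _.
have w0 : 0 <= product_weight q x by exact: product_weight_ge0.
case: ifPn => [_|/forallPn[r]].
  by rewrite lerDl sumr_ge0// => r _; case: ifP.
rewrite -ltNge => xr; rewrite add0r (bigD1 r)//= xr lerDl sumr_ge0// => s _.
by case: ifP.
Unshelve. all: by end_near. Qed.

End asymptotics.

(** * Continuity and compactness on the simplex *)

Section simplex_topology.
Context (R : realType) (c : nat).
Implicit Types (q mu : 'I_c -> R).

(** At 0 the bound is [|u ln u| <= 2 sqrt |u|], obtained from [1 - 1 / s <= ln s] at [s = sqrt u];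
    to the left of 0 the convention [ln u = 0] makes the function vanish. *)
Lemma continuous_mul_ln : continuous (fun u : R => u * ln u).
Proof.
move=> x; have [x0|x0|->] := ltgtP x 0.
- apply: (@cvg_trans _ ((fun=> 0 : R) @ nbhs x)); last first.
    by rewrite ln0 ?ltW// mulr0; exact: cvg_cst.
  apply: near_eq_cvg; near=> u; rewrite ln0 ?mulr0//.
  by apply: ltW; near: u; exact: lt_nbhsl.
- by apply: cvgM; [exact: cvg_id|exact: continuous_ln].
- rewrite /continuous_at mul0r; apply/norm_cvg0P.
  apply: (@squeeze_cvgr _ _ _ _ (fun=> 0) (fun u => 2 * Num.sqrt `|u|)).
  + near=> u; rewrite normr_ge0/=.
    have [u0|u0] := leP u 0; first by rewrite ln0// mulr0 normr0 mulr_ge0.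
    have u1 : u <= 1 by apply: ltW; near: u; exact: lt_nbhsl.
    rewrite normrM (gtr0_norm u0) ler0_norm ?ln_le0//.
    have s0 : 0 < Num.sqrt u by rewrite sqrtr_gt0.
    have us : u = Num.sqrt u ^+ 2 by rewrite sqr_sqrtr// ltW.
    rewrite (_ : ln u = 2 * ln (Num.sqrt u)); last by rewrite {1}us lnXn// mulr_natl.
    have := ln_ge_1subV s0; rewrite -(ler_pM2l s0) mulrBr mulfV ?gt_eqF// => h.
    have : 0 <= Num.sqrt u * (Num.sqrt u * ln (Num.sqrt u) - (Num.sqrt u * 1 - 1)).
      by rewrite mulr_ge0 ?subr_ge0 ?(ltW s0).
    rewrite {4}us; nra.
  + exact: cvg_cst.
  + have : 2 * Num.sqrt `|u| @[u --> (0 : R)] --> 2 * Num.sqrt `|0 : R|.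
      apply: cvgM; first exact: cvg_cst.
      apply: (@cvg_comp _ _ _ Num.norm Num.sqrt); last exact: sqrt_continuous.
      exact: norm_continuous.
    by rewrite normr0 sqrtr0 mulr0.
Unshelve. all: by end_near. Qed.

Lemma continuous_mean_field v (phi : {ffun 'I_v -> 'I_c} -> R) :
  continuous (fun q : 'rV[R]_c => mean_field phi (q ord0)).
Proof.
apply: continuous_big => [|r _]; first exact: add_continuous.
move=> q; apply: (@cvgM _ _ (nbhs q)); first exact: cvg_cst.
have := @continuous_big R 'I_v *%R 1 predT mul_continuous 'rV[R]_c
  (index_enum _) (fun a (q : 'rV[R]_c) => q ord0 (r a)).
by apply => a _; exact: coord_continuous.
Qed.

Lemma continuous_discrete_entropy mu : (forall r, 0 < mu r) ->
  continuous (fun q : 'rV[R]_c => discrete_entropy mu (q ord0)).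
Proof.
move=> mu0; apply: continuous_big => [|r _]; first exact: add_continuous.
rewrite (_ : (fun _ => _) = (fun q : 'rV[R]_c =>
    mu r * ((fun u => u * ln u) (q ord0 r / mu r)))); last first.
  by apply/funext => q; rewrite mulrA [mu r * _]mulrC divfK// gt_eqF.
move=> q; apply: (@cvgM _ _ (nbhs q)); first exact: cvg_cst.
apply: (@cvg_comp _ _ _ (fun q : 'rV[R]_c => q ord0 r / mu r) (fun u => u * ln u));
  last exact: continuous_mul_ln.
by apply: cvgM; [exact: coord_continuous|exact: cvg_cst].
Qed.

Lemma compact_simplex :
  compact [set q : 'rV[R]_c | prob_vector (q ord0)].
Proof.
rewrite (_ : [set _ | _] = [set q : 'rV[R]_c | forall r, `[0, 1]%classic (q ord0 r)] `&`
    [set q : 'rV[R]_c | \sum_r q ord0 r = 1]).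
  apply: compact_closedI.
    apply: (@rV_compact R c (fun=> `[0, 1]%classic)) => r; exact: segment_compact.
  apply: (@closed_comp _ _ (fun q : 'rV[R]_c => \sum_r q ord0 r) [set 1]);
    last exact: closed_eq.
  move=> q _; apply: continuous_big => [|r _]; first exact: add_continuous.
  exact: coord_continuous.
apply/seteqP; split => q /=.
  move=> qP; split=> [r|]; last by case: qP.
  by rewrite /= in_itv/= (prob_vector_le1 r qP) andbT; case: qP.
by move=> [q01 q1]; split => // r; have := q01 r; rewrite /= in_itv/= => /andP[].
Qed.

(** The constraint [h q = t] describes a fibre of the mean field for the rate function; a constant
    [h] gives unconstrained minimisation for the free energy. *)
Lemma simplex_argmin (k h : ('I_c -> R) -> R) (t : R) :
  continuous (fun q : 'rV[R]_c => k (q ord0)) ->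
  continuous (fun q : 'rV[R]_c => h (q ord0)) ->
  (exists2 q, prob_vector q & h q = t) ->
  exists q, [/\ prob_vector q, h q = t &
    forall q', prob_vector q' -> h q' = t -> k q <= k q'].
Proof.
move=> ck ch [q0 q0P q0t].
have rowE (q : 'I_c -> R) : (\row_r q r) ord0 = q by apply/funext => r; rewrite mxE.
have [|||q] := @compact_EVT_min 'rV[R]_c R (fun q : 'rV[R]_c => k (q ord0))
  ([set q : 'rV[R]_c | prob_vector (q ord0)] `&` [set q : 'rV[R]_c | h (q ord0) = t]).
- by exists (\row_r q0 r); rewrite /= rowE.
- apply: compact_closedI; first exact: compact_simplex.
  apply: (@closed_comp _ _ (fun q : 'rV[R]_c => h (q ord0)) [set t]).
    by move=> q _; exact: ch.
  exact: closed_eq.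
- exact: continuous_subspaceT.
rewrite inE => -[/= qP qt] qmin; exists (q ord0); split => // q' q'P q't.
by have := qmin (\row_r q' r); rewrite rowE; apply; rewrite inE/= rowE.
Qed.

(** Each [q] of the compact sublevel set has a neighbourhood and a small gap that work together; the
    near-covering form of compactness makes the gap uniform. *)
Lemma simplex_separation (k h : ('I_c -> R) -> R) (a : R) (F : set R) :
  continuous (fun q : 'rV[R]_c => k (q ord0)) ->
  continuous (fun q : 'rV[R]_c => h (q ord0)) ->
  closed F ->
  (forall q, prob_vector q -> k q <= a -> ~ F (h q)) ->
  exists2 del : R, 0 < del & forall q y, prob_vector q -> k q <= a -> F y ->
    del < `|h q - y|.
Proof.
move=> ck ch cF kF.
have cK : compact ([set q : 'rV[R]_c | prob_vector (q ord0)] `&`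
    [set q : 'rV[R]_c | k (q ord0) <= a]).
  apply: compact_closedI; first exact: compact_simplex.
  apply: (@closed_comp _ _ (fun q : 'rV[R]_c => k (q ord0)) [set u | u <= a]).
    by move=> q _; exact: ck.
  exact: closed_le.
have /compact_near_coveringP H := cK.
have := @H R (0^'+) (fun d (q : 'rV[R]_c) => forall y, F y -> d < `|h (q ord0) - y|) _.
case.
  move=> q [/= qP qa].
  have : nbhs (h (q ord0)) (~` F).
    by apply: open_nbhs_nbhs; split; [exact: closed_openC|exact: kF].
  move=> /nbhs_ballP[e /= e0 eF].
  near=> q' d => y Fy /=; rewrite ltNge; apply/negP => yd.
  apply: (eF y) => //; rewrite /ball/=.
  have : `|h (q ord0) - h (q' ord0)| < e / 2.
    near: q'; have /cvgrPdist_lt hq := ch q; apply: hq.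
    by rewrite divr_gt0.
  have : d < e / 2 by near: d; apply: nbhs_right_lt; rewrite divr_gt0.
  move=> d2 q2; rewrite (le_lt_trans (ler_distD (h (q' ord0)) _ _))//; lra.
move=> e /= e0 He.
exists (e / 2); first by rewrite divr_gt0.
move=> q y qP qa Fy.
have rowE : (\row_r q r) ord0 = q by apply/funext => r; rewrite mxE.
have := He (e / 2); rewrite /ball_/= sub0r normrN gtr0_norm ?divr_gt0//.
rewrite ltr_pdivrMr// ltr_pMr// ltr1n => /(_ isT isT).
by move=> /(_ (\row_r q r)) /=; rewrite rowE; apply.
Unshelve. all: by end_near. Qed.

End simplex_topology.

(** * Reduction of the variational problems to the simplex *)

Section graphon_integrals.
Context (R : realType).
Local Notation leb := (@lebesgue_measure R).
Local Notation U := (`[0%R, 1%R]%classic : set (measurableTypeR R)).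

Lemma lebesgue_unit_interval : leb U = 1%E.
Proof.
by rewrite lebesgue_measure_itv/= lte_fin ltr01 oppr0 adde0.
Qed.

Lemma integrable_unit_bounded (g : measurableTypeR R -> R) (M : R) :
  measurable_fun U g -> (forall u, U u -> `|g u| <= M) ->
  leb.-integrable U (EFin \o g).
Proof.
move=> mg gM; apply: measurable_bounded_integrable => //.
  apply: le_lt_trans (ltry 1); rewrite le_eqVlt; apply/orP; left; apply/eqP.
  exact: lebesgue_unit_interval.
exists M; split; first exact: num_real.
by move=> N MN u /= Uu; apply: le_trans (gM _ Uu) _; apply: ltW.
Qed.

(** Induction on [v]: a [cons_product] integral is one over a product measure, and Tonelli splits
    off the first coordinate. *)
Lemma ge0_integral_lebesgue_tuple v (g : 'I_v -> measurableTypeR R -> R) :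
  (forall a, measurable_fun setT (g a)) -> (forall a u, 0 <= g a u) ->
  (\int[lebesgue_tuple R v]_x (\prod_(a < v) g a (tnth x a))%:E =
   \prod_(a < v) \int[leb]_u (g a u)%:E)%E.
Proof.
elim: v g => [|v ih] g mg g0.
  rewrite big_ord0.
  under eq_integral do rewrite big_ord0.
  by rewrite integral_dirac//= diracT mul1e.
have mtail : measurable_fun setT
    (fun x : v.-tuple (measurableTypeR R) =>
       (\prod_(a < v) g (lift ord0 a) (tnth x a))%:E).
  apply/measurable_EFinP; apply: measurable_prod => a _.
  apply: measurableT_comp; first exact: mg.
  exact: measurable_tnth.
have tail0 (x : v.-tuple (measurableTypeR R)) :
    0 <= \prod_(a < v) g (lift ord0 a) (tnth x a).
  by apply: prodr_ge0.
rewrite /= /cons_product ge0_integral_pushforward//=; last 3 first.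
- exact: measurable_cons measurable_fst measurable_snd.
- apply/measurable_EFinP; apply: measurable_prod => a _.
  apply: measurableT_comp; first exact: mg.
  exact: measurable_tnth.
- by move=> x _; rewrite lee_fin prodr_ge0.
rewrite preimage_setT big_ord_recl -(ih (fun a => g (lift ord0 a)))//.
transitivity (\int[(leb \x lebesgue_tuple R v)%E]_z
    ((g ord0 z.1)%:E * (\prod_(a < v) g (lift ord0 a) (tnth z.2 a))%:E))%E.
  apply: eq_integral => z _ /=; rewrite big_ord_recl EFinM; congr (_%:E * _%:E)%E.
  by apply: eq_bigr => a _; rewrite /tuple_of_pair !(tnth_nth 0)/=.
rewrite fubini_tonelli1//=; last 2 first.
- apply: emeasurable_funM.
    by apply/measurable_EFinP; apply: measurableT_comp => //; exact: mg.
  exact: measurableT_comp mtail measurable_snd.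
- by move=> z; rewrite mule_ge0// lee_fin.
rewrite /fubini_F/=.
rewrite (eq_integral (fun u => (g ord0 u)%:E *
    \int[lebesgue_tuple R v]_x (\prod_(a < v) g (lift ord0 a) (tnth x a))%:E)%E);
  last first.
  move=> u _ /=.
  rewrite ge0_integralZl//; last by rewrite lee_fin g0.
  by move=> x _; rewrite lee_fin.
rewrite ge0_integralZr//.
- by apply/measurable_EFinP; exact: mg.
- by move=> u _; rewrite lee_fin.
- by apply: integral_ge0 => x _; rewrite lee_fin.
Qed.

(* The entries of a fractional colouring are unconstrained outside [0, 1], so
   the integrands are restricted to [0, 1] before Fubini is applied. *)
Lemma integral_prod_unit_cube v (g : 'I_v -> measurableTypeR R -> R) :
  (forall a, measurable_fun U (g a)) ->
  (forall a u, 0 <= u <= 1 -> 0 <= g a u <= 1) ->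
  let G := fun x : v.-tuple (measurableTypeR R) =>
    \prod_(a < v) (g a \_ U) (tnth x a) in
  (lebesgue_tuple R v).-integrable setT (EFin \o G) /\
  \int[lebesgue_tuple R v]_x G x = \prod_(a < v) \int[leb]_(u in U) g a u.
Proof.
move=> mg g01 G.
have mgU a : measurable_fun setT (g a \_ U).
  by apply/(measurable_restrictT _ _).1 => //; exact: mg.
have gU0 a u : 0 <= (g a \_ U) u.
  rewrite /patch; case: ifPn => //; rewrite inE/= in_itv/= => u01.
  by case/andP: (g01 a u u01).
have intg a : leb.-integrable U (EFin \o g a).
  apply: (@integrable_unit_bounded _ 1); first exact: mg.
  move=> u /=; rewrite in_itv/= => u01.
  by case/andP: (g01 a u u01) => g0 g1; rewrite ger0_norm.
have E : (\int[lebesgue_tuple R v]_x (G x)%:E)%E =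
    (\prod_(a < v) \int[leb]_(u in U) g a u)%:E.
  rewrite /G (ge0_integral_lebesgue_tuple (g := fun a => g a \_ U))// -prodEFin.
  apply: eq_bigr => a _.
  rewrite /Rintegral fineK; last by apply: integrable_fin_num => //; exact: intg.
  by rewrite [RHS]integral_mkcond restrict_EFin.
have mG : measurable_fun setT G.
  apply: measurable_prod => a _; apply: measurableT_comp; first exact: mgU.
  exact: measurable_tnth.
split; last by rewrite /Rintegral E.
apply/integrableP; split; first exact/measurable_EFinP.
rewrite (eq_integral (EFin \o G)) => [|x _]; first by rewrite E ltry.
by rewrite /= ger0_norm// prodr_ge0.
Qed.

Definition mean_colouring c (f : 'I_c -> R -> R) (r : 'I_c) : R :=
  \int[leb]_(u in U) f r u.

Lemma integrable_colouring c (f : 'I_c -> R -> R) r :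
  fractional_colourings f -> leb.-integrable U (EFin \o f r).
Proof.
move=> [mf f01 _]; apply: (@integrable_unit_bounded _ 1); first exact: mf.
move=> u /=; rewrite in_itv/= => u01.
by case/andP: (f01 r u u01) => g0 g1; rewrite ger0_norm.
Qed.

Lemma integral_unit_cst (k : R) : (\int[leb]_(u in U) k%:E)%E = k%:E.
Proof. by rewrite integral_cst//= lebesgue_unit_interval mule1. Qed.

Lemma prob_vector_mean_colouring c (f : 'I_c -> R -> R) :
  fractional_colourings f -> prob_vector (mean_colouring f).
Proof.
move=> fP; have [mf f01 f1] := fP; split=> [r|].
  apply: Rintegral_ge0 => u /=; rewrite in_itv/= => u01.
  by case/andP: (f01 r u u01).
apply: EFin_inj; rewrite -sumEFin.
under eq_bigr => r _.
  rewrite /mean_colouring /Rintegral fineK; last first.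
    by apply: integrable_fin_num => //; exact: integrable_colouring.
  over.
rewrite /= -(integral_sum _ (fun r => integrable_colouring r fP))//.
rewrite (eq_integral (fun=> 1%:E)) ?integral_unit_cst// => u.
by rewrite inE/= in_itv/= => u01; rewrite /= sumEFin f1.
Qed.

Lemma graphon_functional_one v c (phi : {ffun 'I_v -> 'I_c} -> R)
    (f : 'I_c -> R -> R) : fractional_colourings f ->
  graphon_functional (fun=> 1) phi f = mean_field phi (mean_colouring f).
Proof.
move=> fP; have [mf f01 f1] := fP.
pose G (r : {ffun 'I_v -> 'I_c}) := fun x : v.-tuple (measurableTypeR R) =>
  \prod_(a < v) (f (r a) \_ U) (tnth x a).
have GP r : (lebesgue_tuple R v).-integrable setT (EFin \o G r) /\
    \int[lebesgue_tuple R v]_x G r x = \prod_(a < v) mean_colouring f (r a).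
  by apply: (@integral_prod_unit_cube v (fun a => f (r a))) => a; [exact: mf|exact: f01].
(* Restricting to the cube is the same as restricting every factor to [0, 1]: outside the cube some
   coordinate makes each product vanish. *)
rewrite /graphon_functional Rintegral_mkcond.
rewrite (@eq_Rintegral _ _ _ _ _ (fun x => \sum_r phi r * G r x)); last first.
  move=> x _; rewrite patchE; case: ifPn => [|xU].
    rewrite inE/= => xU; rewrite mul1r; apply: eq_bigr => r _; congr (_ * _).
    by apply: eq_bigr => a _; rewrite patchE mem_set//= in_itv/=; exact: xU.
  rewrite big1// => r _.
  have [a xa] : exists a, ~ (0 <= tnth x a <= 1).
    by apply/existsNP => h; move/negP: xU; apply; rewrite inE.
  by rewrite /G (bigD1 a)//= patchE memNset ?mul0r ?mulr0//= in_itv.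
rewrite /Rintegral.
under eq_integral do rewrite -sumEFin.
rewrite (integral_sum _ (f := fun r x => (phi r * G r x)%:E))//; last first.
  move=> r; rewrite (_ : (fun _ => _) = (fun x => (phi r)%:E * (EFin \o G r) x)%E)//.
  by apply: integrableZl => //; case: (GP r).
rewrite /mean_field.
under [in LHS]eq_bigr => r _.
  have [iG EG] := GP r.
  under eq_integral do rewrite EFinM.
  rewrite integralZl// -[X in (_ * X)%E]fineK; last exact: integrable_fin_num.
  rewrite -[fine _]/(\int[lebesgue_tuple R v]_x G r x) EG -EFinM; over.
by rewrite sumEFin.
Qed.

(** The left-hand side is the tangent at [k] of the convex function [x ln (x / m)]. *)
Lemma mul_ln_tangent (x m k : R) : 0 <= x -> 0 < m -> 0 < k ->
  x * ln (k / m) + (x - k) <= x * ln (x / m).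
Proof.
move=> x0 m0 k0; have [->|xn0] := eqVneq x 0; first by rewrite !mul0r; lra.
have {xn0} x0 : 0 < x by rewrite lt_neqAle eq_sym xn0.
have : x * (1 - (x / k)^-1) <= x * ln (x / k).
  by rewrite ler_pM2l// ln_ge_1subV// divr_gt0.
rewrite invf_div !ln_div ?posrE// mulrBr mulr1 [x * (k / x)]mulrCA mulfV ?gt_eqF//.
by rewrite mulr1; lra.
Qed.

Lemma bounded_mul_ln (m : R) : 0 < m ->
  exists M : R, forall x, 0 <= x <= 1 -> `|x * ln (x / m)| <= M.
Proof.
move=> m0; exists (`|ln m| + 1) => x /andP[x0 x1].
have [->|xn0] := eqVneq x 0; first by rewrite mul0r normr0 addr_ge0.
have {xn0} x0 : 0 < x by rewrite lt_neqAle eq_sym xn0.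
rewrite ln_div ?posrE// mulrBr (le_trans (ler_normB _ _))// addrC lerD//.
  by rewrite normrM ger0_norm ?(ltW x0)// ler_piMl.
have lx := ln_le0 x1; rewrite normrM gtr0_norm// ler0_norm//.
have : x * (1 - x^-1) <= x * ln x by rewrite ler_pM2l// ln_ge_1subV.
by rewrite mulrBr mulfV ?gt_eqF//; lra.
Qed.

Lemma integrable_entropy_term c (f : 'I_c -> R -> R) r (m : R) : 0 < m ->
  fractional_colourings f ->
  leb.-integrable U (EFin \o (fun u => f r u * ln (f r u / m))).
Proof.
move=> m0 [mf f01 _]; have [M xM] := bounded_mul_ln m0.
apply: (@integrable_unit_bounded _ M).
  apply: measurable_funM; first exact: mf.
  apply: measurableT_comp; first exact: measurable_ln.
  by apply: measurable_funM; first exact: mf.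
by move=> u /=; rewrite in_itv/= => u01; apply/xM/f01.
Qed.

(** Jensen's inequality, by integrating for each colour the tangent at its mean. Colours of mean 0
    use a nearby tangent point, at a total cost of at most [e]. *)
Lemma relative_entropy_ge c (mu : 'I_c -> R) (f : 'I_c -> R -> R) :
  (forall r, 0 < mu r) -> fractional_colourings f ->
  ((discrete_entropy mu (mean_colouring f))%:E <= relative_entropy mu f)%E.
Proof.
move=> mu0 fP; have [mf f01 _] := fP; have [k0 _] := prob_vector_mean_colouring fP.
set k := mean_colouring f in k0 *.
have int1 : leb.-integrable U
    (EFin \o (fun u => \sum_r f r u * ln (f r u / mu r))).
  rewrite (_ : _ \o _ =
      (fun u => \sum_r (EFin \o (fun u => (f r u * ln (f r u / mu r))%R)) u)%E).
    by apply: integrable_sum => // r _; exact: integrable_entropy_term.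
  by apply/funext => u; rewrite /= sumEFin.
apply/lee_addgt0Pr => e e0.
have c0 : 0 < c.+1%:R :> R by [].
(* u ln u has infinite slope at 0: there the tangent is taken at e / c.+1. *)
pose k' r := if k r == 0 then e / c.+1%:R else k r.
have k'0 r : 0 < k' r.
  by rewrite /k'; case: eqVneq => [_|kr]; rewrite ?divr_gt0// lt_neqAle eq_sym kr/=.
pose a r := ln (k' r / mu r).
have int2 r : leb.-integrable U (EFin \o (fun u => f r u * a r + (f r u - k' r))).
  rewrite (_ : _ \o _ =
    (fun u => (a r + 1)%:E * (EFin \o f r) u + (- k' r)%:E)%E); last first.
    by apply/funext => u /=; rewrite -EFinM -EFinD; congr EFin; ring.
  apply: integrableD => //.
    by apply: integrableZl => //; exact: integrable_colouring.
  by apply: (@integrable_unit_bounded (fun=> - k' r) `|k' r|) => // u _; rewrite normrN.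
have I2 r : (\int[leb]_(u in U) (f r u * a r + (f r u - k' r))%:E)%E =
    (k r * a r + (k r - k' r))%:E.
  have kE : (\int[leb]_(u in U) (EFin \o f r) u)%E = (k r)%:E.
    by rewrite /k /mean_colouring /Rintegral fineK//; apply: integrable_fin_num => //;
      exact: integrable_colouring.
  rewrite (eq_integral
    (fun u : measurableTypeR R => (a r + 1)%:E * (EFin \o f r) u + (- k' r)%:E)%E); last first.
    by move=> u _ /=; rewrite -EFinM -EFinD; congr EFin; ring.
  rewrite integralD//; last 2 first.
  - by apply: integrableZl => //; exact: integrable_colouring.
  - by apply: (@integrable_unit_bounded (fun=> - k' r) `|k' r|) => // u _; rewrite normrN.
  rewrite integralZl//; last exact: integrable_colouring.
  by rewrite kE integral_unit_cst -EFinM -EFinD; congr EFin; ring.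
have : ((\sum_r (k r * a r + (k r - k' r)))%:E <= relative_entropy mu f)%E.
  rewrite -sumEFin.
  under eq_bigr do rewrite -I2.
  rewrite -(integral_sum _ int2)//; apply: le_integral => //.
    by apply: integrable_sum => // r _; exact: int2.
  move=> u; rewrite inE/= in_itv/= => u01; rewrite sumEFin lee_fin.
  by apply: ler_sum => r _; apply: mul_ln_tangent => //; case/andP: (f01 r u u01).
apply: (fun h1 h2 => le_trans h1 (leeD2r e%:E h2)).
rewrite -EFinD lee_fin -lerBlDr.
rewrite (_ : discrete_entropy mu k = \sum_r k r * a r); last first.
  apply: eq_bigr => r _; rewrite /a /k'; case: eqVneq => [->|//].
  by rewrite !mul0r.
rewrite lerBlDr -lerBlDl -sumrB.
apply: (@le_trans _ _ (\sum_(r < c) e / c.+1%:R)).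
  apply: ler_sum => r _; rewrite /k'; rewrite opprD addNKr opprB.
  case: eqVneq => [->|_]; first by rewrite subr0.
  by rewrite subrr divr_ge0 ?(ltW e0).
rewrite sumr_const card_ord -[_ *+ c]mulr_natl mulrCA ler_piMr ?(ltW e0)//.
by rewrite ler_pdivrMr// mul1r ler_nat.
Qed.

Lemma fractional_colouring_cst c (q : 'I_c -> R) : prob_vector q ->
  fractional_colourings (fun r _ => q r).
Proof.
move=> qP; split=> [r|r x _|x _]; first exact: measurable_cst.
  by rewrite (prob_vector_le1 r qP) andbT; case: qP.
by case: qP.
Qed.

Lemma mean_colouring_cst c (q : 'I_c -> R) : mean_colouring (fun r _ => q r) = q.
Proof. by apply/funext => r; rewrite /mean_colouring /Rintegral integral_unit_cst. Qed.

Lemma relative_entropy_cst c (mu q : 'I_c -> R) :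
  relative_entropy mu (fun r _ => q r) = (discrete_entropy mu q)%:E.
Proof. by rewrite /relative_entropy integral_unit_cst. Qed.

End graphon_integrals.

(** * Rate function, free energy and deterministic large deviations *)

Section variational.
Context (R : realType) (c v : nat) (phi : {ffun 'I_v -> 'I_c} -> R).
Context (mu : 'I_c -> R) (mu_gt0 : forall r, 0 < mu r).

(** Gibbs' inequality: the tangent at [mu r] bounds each term below by [q r - mu r], and these sum
    to 0. *)
Lemma discrete_entropy_ge0 q : prob_vector mu -> prob_vector q ->
  0 <= discrete_entropy mu q.
Proof.
move=> [_ mu1] [q0 q1].
rewrite -(subrr 1) -{1}q1 -mu1 -sumrB; apply: ler_sum => r _.
have := mul_ln_tangent (q0 r) (mu_gt0 r) (mu_gt0 r).
by rewrite divff ?gt_eqF// ln1 mulr0 add0r.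
Qed.

Lemma rate_one_le q : prob_vector q ->
  (rate_one phi mu (mean_field phi q) <= (discrete_entropy mu q)%:E)%E.
Proof.
move=> qP; rewrite -relative_entropy_cst; apply: ereal_inf_lbound.
exists (fun r _ => q r) => //; split; first exact: fractional_colouring_cst.
rewrite graphon_functional_one ?mean_colouring_cst//.
exact: fractional_colouring_cst.
Qed.

(** Entropy is finite on the simplex, so the value is infinite only when no law has mean field [t];
    otherwise the compact fibre contains a minimiser. *)
Lemma rate_one_attained t : rate_one phi mu t = +oo%E \/
  exists q, [/\ prob_vector q, mean_field phi q = t &
    rate_one phi mu t = (discrete_entropy mu q)%:E].
Proof.
have [qt|noq] := pselect (exists2 q, prob_vector q & mean_field phi q = t).
  right; have [q [qP hq qmin]] := simplex_argmin
    (continuous_discrete_entropy mu_gt0) (@continuous_mean_field R c v phi) qt.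
  exists q; split => //; apply/eqP; rewrite eq_le -{1}hq rate_one_le//=.
  apply: le_ereal_inf_tmp => _ [f [fP ft] <-].
  apply: le_trans (relative_entropy_ge mu_gt0 fP).
  rewrite lee_fin; apply: qmin; first exact: prob_vector_mean_colouring.
  by rewrite -graphon_functional_one.
left; rewrite /rate_one (_ : [set _ | _ in _] = set0) ?ereal_inf0//.
rewrite -subset0 => y [f [fP ft] _]; apply: noq; exists (mean_colouring f).
  exact: prob_vector_mean_colouring.
by rewrite -graphon_functional_one.
Qed.

Lemma rate_one_ge0 t : prob_vector mu -> (0 <= rate_one phi mu t)%E.
Proof.
move=> muP; have [->|[q [qP _ ->]]] := rate_one_attained t; first exact: leey.
by rewrite lee_fin discrete_entropy_ge0.
Qed.

(** Since the infimum is attained, a sublevel set is exactly the continuous image of the compact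
    entropy sublevel set. *)
Lemma good_rate_one : prob_vector mu -> good_rate_function (rate_one phi mu).
Proof.
move=> muP; split=> [t|a]; first exact: rate_one_ge0.
rewrite (_ : [set _ | _] = (fun q : 'rV[R]_c => mean_field phi (q ord0)) @`
    ([set q : 'rV[R]_c | prob_vector (q ord0)] `&`
     [set q : 'rV[R]_c | discrete_entropy mu (q ord0) <= a])).
  apply: continuous_compact.
    by apply: continuous_subspaceT; exact: continuous_mean_field.
  apply: compact_closedI; first exact: compact_simplex.
  apply: (@closed_comp _ _ (fun q : 'rV[R]_c => discrete_entropy mu (q ord0))
    [set u | u <= a]); last exact: closed_le.
  by move=> q _; exact: continuous_discrete_entropy.
apply/seteqP; split=> [t /= ta|t /= [q [qP qa] <-]].
  have [toy|[q [qP qt qJ]]] := rate_one_attained t; first by rewrite toy leye_eq in ta.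
  have rowE : (\row_r q r) ord0 = q by apply/funext => r; rewrite mxE.
  exists (\row_r q r); rewrite /= rowE//.
  by split => //; rewrite -lee_fin -qJ.
by rewrite (le_trans (rate_one_le qP))// lee_fin.
Qed.

Lemma free_energy_attained (beta : R) : (0 < c)%N ->
  exists q, [/\ prob_vector q,
    forall q', prob_vector q' -> beta * mean_field phi q' - discrete_entropy mu q' <=
      beta * mean_field phi q - discrete_entropy mu q,
    free_energy phi mu beta (fun r _ => q r) =
      (beta * mean_field phi q - discrete_entropy mu q)%:E &
    ereal_sup [set free_energy phi mu beta f | f in @fractional_colourings R c] =
      (beta * mean_field phi q - discrete_entropy mu q)%:E].
Proof.
move=> c0.
have E q : prob_vector q -> free_energy phi mu beta (fun r _ => q r) =
    (beta * mean_field phi q - discrete_entropy mu q)%:E.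
  move=> qP; rewrite /free_energy graphon_functional_one; last exact: fractional_colouring_cst.
  by rewrite mean_colouring_cst relative_entropy_cst EFinB.
have ck : continuous (fun q : 'rV[R]_c =>
    discrete_entropy mu (q ord0) - beta * mean_field phi (q ord0)).
  move=> q; apply: (@cvgB _ _ _ (nbhs q)); first exact: continuous_discrete_entropy.
  by apply: (@cvgM _ _ (nbhs q)); [exact: cvg_cst|exact: continuous_mean_field].
(* A vacuous constraint [0 = 0], so that [simplex_argmin] ranges over the whole simplex; a vertex
   shows that the simplex is inhabited. *)
have ch : continuous (fun q : 'rV[R]_c => (0 : R)) by exact: cst_continuous.
have q0 : exists2 q : 'I_c -> R, prob_vector q & (fun=> 0 : R) q = 0.
  exists (fun r => (r == Ordinal c0)%:R) => //; split=> [r|]; first exact: ler0n.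
  by rewrite (bigD1 (Ordinal c0))//= big1 ?addr0 => [|r /negPf ->]; rewrite ?eqxx.
have [q [qP _ qmin]] := simplex_argmin
  (k := fun q => discrete_entropy mu q - beta * mean_field phi q) ck ch q0.
have qmax q' : prob_vector q' -> beta * mean_field phi q' - discrete_entropy mu q' <=
    beta * mean_field phi q - discrete_entropy mu q.
  by move=> q'P; rewrite -lerN2 !opprB; exact: qmin.
exists q; split=> //; first exact: E.
apply/eqP; rewrite eq_le; apply/andP; split; last first.
  by rewrite -E//; apply: ereal_sup_ubound; exists (fun r _ => q r) => //;
    exact: fractional_colouring_cst.
apply: ge_ereal_sup => _ [f fP <-].
have := qmax _ (prob_vector_mean_colouring fP); rewrite -lee_fin.
apply: le_trans; rewrite EFinB /free_energy graphon_functional_one//.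
by apply: leeB => //; exact: relative_entropy_ge.
Qed.

Lemma mean_field_near (q : 'I_c -> R) (e : R) : 0 < e -> exists2 eta : R, 0 < eta &
  forall q', (forall r, `|q' r - q r| <= eta) ->
    `|mean_field phi q' - mean_field phi q| < e.
Proof.
move=> e0.
have rowE (p : 'I_c -> R) : (\row_r p r) ord0 = p by apply/funext => r; rewrite mxE.
have /cvgrPdist_lt /(_ _ e0) := @continuous_mean_field R c v phi (\row_r q r).
move=> /nbhs_ballP[d /= d0 dP]; exists (d / 2); first by rewrite divr_gt0.
move=> q' q'q; have := dP (\row_r q' r); rewrite !rowE distrC; apply.
split=> // i j; rewrite !mxE /ball/= distrC (le_lt_trans (q'q j))//.
by rewrite ltr_pdivrMr// ltr_pMr// ltr1n.
Qed.

(** The only property of the tensor used below: it is uniform over all colourings and involves no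
    probability. *)
Definition tensor_close n (del : R) (Q : tensor R v n) : Prop :=
  forall x, `|tensor_avg Q phi x - mean_field phi (empirical x)| <= del.

Lemma le_ln_scaled n (m s : R) : (0 < n)%N -> 0 <= m -> m <= expR (n%:R * s) ->
  ((n%:R^-1)%:E * lne m%:E <= s%:E)%E.
Proof.
move=> n0 m0 ms; have n0R : 0 < n%:R :> R by rewrite ltr0n.
have [->|mn0] := eqVneq m 0.
  by rewrite le0_lneNy// gt0_muleNy ?leNye// lte_fin invr_gt0.
have {}m0 : 0 < m by rewrite lt_neqAle eq_sym mn0.
rewrite lne_EFin// -EFinM lee_fin mulrC ler_pdivrMr// mulrC.
by rewrite -[leRHS]expRK ler_ln// posrE ?expR_gt0.
Qed.

Lemma ge_ln_scaled n (m s : R) : (0 < n)%N -> expR (n%:R * s) <= m ->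
  (s%:E <= (n%:R^-1)%:E * lne m%:E)%E.
Proof.
move=> n0 ms; have n0R : 0 < n%:R :> R by rewrite ltr0n.
have m0 : 0 < m by apply: lt_le_trans ms; exact: expR_gt0.
rewrite lne_EFin// -EFinM lee_fin mulrC ler_pdivlMr// mulrC.
by rewrite -[leLHS]expRK ler_ln// posrE ?expR_gt0.
Qed.

(** If the average for a close [Q] lies in [F], the mean field of the empirical law lies within
    [del] of [F]. Separation then forces the entropy of that law above the infimum minus [eps / 2];
    the polynomial number of types costs the other half. *)
Lemma ldp_upper_bound (F : set R) (eps : R) : prob_vector mu -> 0 < eps ->
  exists2 del : R, 0 < del & \forall n \near \oo, forall Q : tensor R v n,
    tensor_close del Q ->
    ((n%:R^-1)%:E *
       lne (\sum_(x | `[< F (tensor_avg Q phi x) >]) product_weight mu x)%:E <=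
     - ereal_inf (rate_one phi mu @` closure F) + eps%:E)%E.
Proof.
move=> muP eps0; have mu0 r : 0 <= mu r by exact: ltW.
set I := ereal_inf _.
have I_le q : prob_vector q -> closure F (mean_field phi q) ->
    (I <= (discrete_entropy mu q)%:E)%E.
  move=> qP qF; apply: le_trans (rate_one_le qP).
  by apply: ereal_inf_lbound; exists (mean_field phi q).
have : (0 <= I)%E by apply: le_ereal_inf_tmp => _ [t _ <-]; exact: rate_one_ge0.
case: I I_le => [l||//] I_le _.
- have nF q : prob_vector q -> discrete_entropy mu q <= l - eps / 2 ->
      ~ closure F (mean_field phi q).
    by move=> qP qa qF; have := I_le q qP qF; rewrite lee_fin; lra.
  have [del del0 Hd] := @simplex_separation R c (discrete_entropy mu)
    (mean_field phi) (l - eps / 2) (closure F)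
    (continuous_discrete_entropy mu_gt0) (@continuous_mean_field R c v phi)
    (@closed_closure _ F) nF.
  exists del => //; near=> n => Q Qd.
  have n0 : (0 < n)%N by near: n; exact: nbhs_infty_ge.
  rewrite -EFinN -EFinD; apply: le_ln_scaled => //.
    by apply: sumr_ge0 => x _; exact: product_weight_ge0.
  pose B := [set q : 'I_c -> R | exists2 y, F y & `|mean_field phi q - y| <= del].
  apply: (@le_trans _ _ (\sum_(x : {ffun 'I_n -> 'I_c} | `[< B (empirical x) >])
      product_weight mu x * expR (n%:R * (fun=> 0) (empirical (R := R) x)))).
    rewrite big_mkcond [leRHS]big_mkcond/=; apply: ler_sum => x _.
    have w0 : 0 <= product_weight mu x by exact: product_weight_ge0.
    rewrite mulr0 expR0 mulr1.
    case: ifPn => [/asboolP Fx|_]; last by case: ifP.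
    rewrite ifT//; apply/asboolP; exists (tensor_avg Q phi x) => //.
    by rewrite distrC.
  apply: (le_trans (@laplace_upper_bound R c mu n (fun=> 0) B (eps / 2 - l) n0 mu_gt0 _)).
    move=> q qP [y Fy yq]; rewrite sub0r lerNl opprB leNgt; apply/negP => qa.
    by have := Hd q y qP (ltW qa) (subset_closure Fy); rewrite ltNge yq.
  have h : n.+1%:R ^+ c <= expR (n%:R * (eps / 2)).
    by near: n; apply: near_polynomial_le_expR; rewrite divr_gt0.
  apply: (le_trans (ler_wpM2r (expR_ge0 _) h)).
  by rewrite -expRD ler_expR -mulrDr ler_wpM2l//; lra.
(* Infinite infimum: no law at all has its mean field in the closure of [F]. With entropy replaced
   by 0 the separation covers the whole simplex, and the event is empty. *)
- have nF q : prob_vector q -> 0 <= 0 :> R -> ~ closure F (mean_field phi q).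
    by move=> qP _ qF; have := I_le q qP qF; rewrite leye_eq.
  have [del del0 Hd] := @simplex_separation R c (fun=> 0)
    (mean_field phi) 0 (closure F) (@cst_continuous _ _ 0) (@continuous_mean_field R c v phi)
    (@closed_closure _ F) nF.
  exists del => //; near=> n => Q Qd.
  have n0 : (0 < n)%N by near: n; exact: nbhs_infty_ge.
  rewrite big1 => [|x /asboolP Fx]; last first.
    have := Hd _ _ (prob_vector_empirical R x n0) (lexx _) (subset_closure Fx).
    by rewrite distrC ltNge Qd.
  rewrite le0_lneNy// gt0_muleNy ?leNye// lte_fin invr_gt0.
  by rewrite ltr0n.
Unshelve. all: by end_near. Qed.

(** A near-optimal [t] in the interior of [F] is realised by some law [q]. Colourings with empirical
    law near [q] have their averages in a ball around [t] inside [F], one third of the radius going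
    to the law and one third to the tensor. *)
Lemma ldp_lower_bound (F : set R) (eps : R) : prob_vector mu -> 0 < eps ->
  exists2 del : R, 0 < del & \forall n \near \oo, forall Q : tensor R v n,
    tensor_close del Q ->
    (- ereal_inf (rate_one phi mu @` interior F) - eps%:E <= (n%:R^-1)%:E *
       lne (\sum_(x | `[< F (tensor_avg Q phi x) >]) product_weight mu x)%:E)%E.
Proof.
move=> muP eps0; have mu0 r : 0 <= mu r by exact: ltW.
set I := ereal_inf _.
have I0 : (0 <= I)%E by apply: le_ereal_inf_tmp => _ [t _ <-]; exact: rate_one_ge0.
have [Ioo|Ifin] := eqVneq I +oo%E.
  by exists 1 => //; near=> n => Q _; rewrite Ioo/= leNye.
have IE : I = (fine I)%:E by rewrite fineK// ge0_fin_numE// ltey.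
have [_ [t Ft <-] tI] : exists2 y, (rate_one phi mu @` interior F) y &
    (y < I + (eps / 2)%:E)%E.
  apply: lb_ereal_inf_adherent; first by rewrite divr_gt0.
  by rewrite ge0_fin_numE// ltey.
have [toy|[q [qP qt qJ]]] := rate_one_attained t; first by move: tI; rewrite toy ltNge leey.
have /nbhs_ballP[e /= e0 eF] : nbhs t F by [].
have e30 : 0 < e / 3 by rewrite divr_gt0.
have [eta1 eta10 Heta] := mean_field_near q e30.
pose eta := Num.min eta1 (eps / 2).
have eta0 : 0 < eta by rewrite lt_min eta10 divr_gt0.
exists (e / 3) => //; near=> n => Q Qd.
have n0 : (0 < n)%N by near: n; exact: nbhs_infty_ge.
rewrite IE -EFinN -EFinB; apply: ge_ln_scaled => //.
apply: (@le_trans _ _ (expR (- (n%:R * (discrete_entropy mu q + eta))))).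
  rewrite ler_expR -mulrN ler_wpM2l//.
  move: tI; rewrite qJ IE -EFinD lte_fin => tI.
  have : eta <= eps / 2 by rewrite ge_min lexx orbT.
  lra.
apply: (@le_trans _ _ (\sum_(x : {ffun 'I_n -> 'I_c} |
        [forall r, `|empirical x r - q r| <= eta]) product_weight mu x)).
  by near: n; exact: laplace_lower_bound.
rewrite big_mkcond [leRHS]big_mkcond/=; apply: ler_sum => x _.
have w0 : 0 <= product_weight mu x by exact: product_weight_ge0.
case: ifPn => [/forallP xq|_]; last by case: ifP.
rewrite ifT//; apply/asboolP; apply: eF; rewrite /ball/= -qt.
have h1 : `|mean_field phi (empirical x) - mean_field phi q| < e / 3.
  by apply: Heta => r; apply: le_trans (xq r) _; rewrite ge_min lexx.
have h2 := Qd x.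
rewrite distrC (le_lt_trans (ler_distD (mean_field phi (empirical x)) _ _))//.
lra.
Unshelve. all: by end_near. Qed.

(** Varadhan's lemma in this finite setting, the upper bound by types and the lower bound near the
    maximiser [q]. *)
Lemma log_partition_close (beta eps s : R) (q : 'I_c -> R) :
  prob_vector mu -> 0 < eps -> prob_vector q ->
  s = beta * mean_field phi q - discrete_entropy mu q ->
  (forall q', prob_vector q' ->
     beta * mean_field phi q' - discrete_entropy mu q' <= s) ->
  exists2 del : R, 0 < del & \forall n \near \oo, forall Q : tensor R v n,
    tensor_close del Q -> `|log_partition phi mu beta Q - s| < eps.
Proof.
move=> muP eps0 qP sE smax; have mu0 r : 0 <= mu r by exact: ltW.
(* The added 1 keeps [b] positive when [beta = 0]. The error budget is [eps / 4] above (tensor and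
   types) and [3 * eps / 8] below (tensor, law and [eta]), each under [eps / 2]. *)
pose b := `|beta| + 1.
have b0 : 0 < b by rewrite ltr_wpDl.
pose e := eps / 8 / b.
have e0 : 0 < e by rewrite !divr_gt0.
have be : b * e = eps / 8 by rewrite /e mulrCA mulfV ?mulr1// gt_eqF.
have bx (y z del : R) : `|y - z| <= del -> `|beta * y - beta * z| <= b * del.
  move=> yz; rewrite -mulrBr normrM; apply: ler_pM => //.
  by rewrite /b lerDl.
have [eta1 eta10 Heta] := mean_field_near q e0.
pose eta := Num.min eta1 (eps / 8).
have eta0 : 0 < eta by rewrite lt_min eta10 divr_gt0.
exists e => //; near=> n => Q Qd.
have n0 : (0 < n)%N by near: n; exact: nbhs_infty_ge.
have n0R : 0 < n%:R :> R by rewrite ltr0n.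
have up : product_expectation mu (fun x => expR (n%:R * beta * tensor_avg Q phi x)) <=
    expR (n%:R * (s + eps / 2)).
  apply: (@le_trans _ _ (\sum_(x : {ffun 'I_n -> 'I_c} | `[< setT (empirical (R := R) x) >])
      product_weight mu x *
        expR (n%:R * (fun q => beta * mean_field phi q + b * e) (empirical x)))).
    rewrite /product_expectation [leRHS]big_mkcond/=; apply: ler_sum => x _.
    rewrite ifT; last exact/asboolP.
    rewrite ler_wpM2l ?product_weight_ge0// ler_expR -mulrA ler_wpM2l//.
    have := bx _ _ _ (Qd x); rewrite ler_norml => /andP[]; lra.
  apply: (le_trans (@laplace_upper_bound R c mu n
    (fun q => beta * mean_field phi q + b * e) setT (s + b * e) n0 mu_gt0 _)).
    by move=> q' q'P _; have := smax _ q'P; lra.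
  have h : n.+1%:R ^+ c <= expR (n%:R * (eps / 8)).
    by near: n; apply: near_polynomial_le_expR; rewrite divr_gt0.
  apply: (le_trans (ler_wpM2r (expR_ge0 _) h)).
  by rewrite -expRD ler_expR -mulrDr ler_wpM2l//; lra.
have lo : expR (n%:R * (s - eps / 2)) <=
    product_expectation mu (fun x => expR (n%:R * beta * tensor_avg Q phi x)).
  apply: (@le_trans _ _ (\sum_(x : {ffun 'I_n -> 'I_c} |
      [forall r, `|empirical x r - q r| <= eta]) product_weight mu x *
        expR (n%:R * (beta * mean_field phi q - eps / 4)))); last first.
    rewrite /product_expectation big_mkcond/=; apply: ler_sum => x _.
    have w0 : 0 <= product_weight mu x by exact: product_weight_ge0.
    case: ifPn => [/forallP xq|_]; last by rewrite mulr_ge0 ?expR_ge0.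
    rewrite ler_wpM2l// ler_expR -mulrA ler_wpM2l//.
    have h1 : `|mean_field phi (empirical x) - mean_field phi q| <= e.
      by apply/ltW/Heta => r; apply: le_trans (xq r) _; rewrite ge_min lexx.
    have := bx _ _ _ (Qd x); have := bx _ _ _ h1.
    by rewrite !ler_norml => /andP[? ?] /andP[? ?]; lra.
  rewrite -mulr_suml.
  apply: (@le_trans _ _ (expR (- (n%:R * (discrete_entropy mu q + eta))) *
    expR (n%:R * (beta * mean_field phi q - eps / 4)))); last first.
    rewrite ler_wpM2r ?expR_ge0//; near: n; exact: laplace_lower_bound.
  rewrite -expRD ler_expR -[- (n%:R * _)]mulrN -mulrDr ler_wpM2l//.
  have : eta <= eps / 8 by rewrite ge_min lexx orbT.
  lra.
set Z := product_expectation _ _ in up lo.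
have Z0 : 0 < Z by apply: lt_le_trans lo; exact: expR_gt0.
rewrite /log_partition -/Z mulrC ltr_distl.
rewrite ltr_pdivlMr// ltr_pdivrMr//.
apply/andP; split.
  apply: (@lt_le_trans _ _ (n%:R * (s - eps / 2))).
    by rewrite mulrC ltr_pM2l//; lra.
  by rewrite -[leLHS]expRK ler_ln// posrE ?expR_gt0.
apply: (@le_lt_trans _ _ (n%:R * (s + eps / 2))).
  by rewrite -[leRHS]expRK ler_ln// posrE ?expR_gt0.
by rewrite mulrC ltr_pM2r//; lra.
Unshelve. all: by end_near. Qed.

End variational.

(** * Concentration of the hypergraph tensor *)

Section edge_tensors.
Context (R : realType) (v n : nat).

Definition edge := {e : {set 'I_n} | #|e| == v}.

(** By [injective_edge] the inner [insub] succeeds at every injective tuple, so its default 0 is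
    never reached. *)
Definition edge_tensor (y : edge -> R) : tensor R v n := fun i =>
  if injectiveb i then
    if insub [set i a | a : 'I_v]%SET is Some e then y e else 0
  else 0.

Lemma injective_edge (i : {ffun 'I_v -> 'I_n}) : injectiveb i ->
  #|[set i a | a : 'I_v]%SET| == v.
Proof. by move=> /injectiveP ii; rewrite card_imset// card_ord. Qed.

(** The coefficient of one edge variable in the unnormalised average. Tuples that are permutations
    of each other share a variable, so independence is available only after this grouping. *)
Definition edge_sum c (phi : {ffun 'I_v -> 'I_c} -> R) (x : {ffun 'I_n -> 'I_c})
    (e : edge) : R :=
  \sum_(i : {ffun 'I_v -> 'I_n} | injectiveb i && ([set i a | a : 'I_v]%SET == val e))
    phi [ffun a => x (i a)].

Lemma sum_edge_tensor c (phi : {ffun 'I_v -> 'I_c} -> R) (x : {ffun 'I_n -> 'I_c})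
    (y : edge -> R) :
  \sum_(i : {ffun 'I_v -> 'I_n}) edge_tensor y i * phi [ffun a => x (i a)] =
  \sum_e y e * edge_sum phi x e.
Proof.
rewrite /edge_sum.
under [RHS]eq_bigr => e _ do rewrite big_mkcond mulr_sumr/=.
rewrite exchange_big/=; apply: eq_bigr => i _; rewrite /edge_tensor.
case: ifPn => [ii|ii]; last first.
  by rewrite mul0r big1// => e _; rewrite /= mulr0.
rewrite insubT; first exact: injective_edge.
move=> iv; rewrite (bigD1 (Sub [set i a | a : 'I_v]%SET iv : edge))//=.
rewrite eqxx big1 ?addr0// => e; rewrite -val_eqE/= eq_sym => /negPf ->.
by rewrite mulr0.
Qed.

Lemma tensor_avg_edge c (phi : {ffun 'I_v -> 'I_c} -> R) (x : {ffun 'I_n -> 'I_c})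
    (y : edge -> R) :
  tensor_avg (edge_tensor y) phi x =
  (n%:R ^+ v)^-1 * \sum_e y e * edge_sum phi x e.
Proof. by rewrite /tensor_avg sum_edge_tensor. Qed.

Lemma edge_tensor1 i : edge_tensor (fun=> 1) i = (injectiveb i)%:R.
Proof.
rewrite /edge_tensor; case: ifPn => // ii.
by rewrite insubT//; exact: injective_edge.
Qed.

Context (c : nat) (phi : {ffun 'I_v -> 'I_c} -> R) (M : R).
Hypothesis M0 : 0 <= M.
Hypothesis phiM : forall r, `|phi r| <= M.

(** All [v ^ v] maps into the edge are counted, as a crude bound for its orderings. *)
Lemma edge_sum_le x (e : edge) : `|edge_sum phi x e| <= M * (v ^ v)%:R.
Proof.
apply: le_trans (ler_norm_sum _ _ _) _.
apply: (@le_trans _ _ (\sum_(i : {ffun 'I_v -> 'I_n} | i \in ffun_on (mem (val e))) M)).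
  rewrite big_mkcond [leRHS]big_mkcond/=; apply: ler_sum => i _.
  case: ifPn => [/andP[_ /eqP ie]|_]; last by case: ifP.
  rewrite ifT//; apply/ffun_onP => a; rewrite -ie.
  by apply/imsetP; exists a.
rewrite sumr_const card_ffun_on card_ord -[leLHS]mulr_natr ler_wpM2l// ler_nat.
by rewrite (eqP (valP e)).
Qed.

(** Edges partition the injective tuples. Together with the uniform bound this controls the sum of
    squares in the variance. *)
Lemma sum_edge_sum_le x : \sum_e `|edge_sum phi x e| <= M * n%:R ^+ v.
Proof.
apply: (@le_trans _ _ (\sum_e 1 * edge_sum (fun=> M) x e)).
  apply: ler_sum => e _; rewrite mul1r (le_trans (ler_norm_sum _ _ _))//.
  by apply: ler_sum => i _.
rewrite -(sum_edge_tensor _ _ (fun=> 1)).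
apply: (@le_trans _ _ (\sum_(i : {ffun 'I_v -> 'I_n}) M)).
  by apply: ler_sum => i _; rewrite edge_tensor1; case: injectiveb; rewrite ?mul1r ?mul0r.
by rewrite sumr_const card_ffun !card_ord -[M *+ _]mulr_natr natrX.
Qed.

End edge_tensors.

(** The number of tuples with a repetition is at most [v ^ 2 * n ^ (v - 1)]; multiplying by [n]
    avoids the truncated exponent. *)
Lemma expn_le_ffact n v : (n ^ v * n <= n ^_ v * n + v ^ 2 * n ^ v)%N.
Proof.
elim: v => [|v ih]; first by rewrite ffactn0 expn0 leq_addr.
have ff : (n ^_ v <= n ^ v)%N.
  by elim: v {ih} => // v ih; rewrite ffactnSr expnSr leq_mul// leq_subr.
have h1 : (n ^_ v * n <= n ^_ v * (n - v) + n ^_ v * v)%N.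
  by rewrite -mulnDr leq_mul//; lia.
have h2 : (n ^_ v * v <= n ^ v * v)%N by rewrite leq_mul.
rewrite ffactnSr expnS (_ : v.+1 ^ 2 = v ^ 2 + v * 2 + 1)%N; last by lia.
have := leq_mul ih (leqnn n).
have := leq_mul h1 (leqnn n).
have := leq_mul h2 (leqnn n).
move: (n ^ v)%N (n ^_ v)%N (v ^ 2)%N (n - v)%N => u f w t.
nia.
Qed.

Section edge_concentration.
Context (R : realType) (v n c : nat) (phi : {ffun 'I_v -> 'I_c} -> R) (M p : R).
Hypothesis n0 : (0 < n)%N.
Hypothesis M0 : 0 <= M.
Hypothesis phiM : forall r, `|phi r| <= M.
Hypothesis p01 : 0 < p <= 1.
Local Notation edges := (edge v n).

Definition config_tensor (a : {ffun edges -> bool}) : tensor R v n :=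
  edge_tensor (fun e => if a e then p^-1 else 0).

Definition config_weight (a : {ffun edges -> bool}) : R :=
  \prod_e (if a e then p else 1 - p).

Lemma config_weight_ge0 a : 0 <= config_weight a.
Proof.
by have [p0 p1] := andP p01; apply: prodr_ge0 => e _; case: ifP => _; lra.
Qed.

Lemma sum_config_weight : \sum_a config_weight a = 1.
Proof.
apply: (@sum_prod_weights R edges bool (fun _ b => if b then p else 1 - p)) => e.
by rewrite big_bool/= addrC subrK.
Qed.

(** The two averages differ exactly by the tuples with a repetition. *)
Lemma edge_average_bias (x : {ffun 'I_n -> 'I_c}) :
  `|(n%:R ^+ v)^-1 * (\sum_e edge_sum phi x e) - mean_field phi (empirical x)| <=
  M * (v ^ 2)%:R / n%:R.
Proof.
have n0R : 0 < n%:R :> R by rewrite ltr0n.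
rewrite -tensor_avg1 /tensor_avg -mulrBr.
have -> : \sum_e edge_sum phi x e = \sum_e 1 * edge_sum phi x e.
  by apply: eq_bigr => e _; rewrite mul1r.
rewrite -(sum_edge_tensor _ _ (fun=> 1)) -sumrB normrM ger0_norm ?invr_ge0 ?exprn_ge0//.
rewrite ler_pdivrMl ?exprn_gt0//.
apply: le_trans (ler_norm_sum _ _ _) _.
apply: (@le_trans _ _ (\sum_(i : {ffun 'I_v -> 'I_n}) M * (1 - (injectiveb i)%:R))).
  apply: ler_sum => i _; rewrite edge_tensor1 -mulrBl normrM mulrC.
  by case: injectiveb; rewrite ?subrr ?normr0 ?mulr0// subr0 sub0r normrN1 ?normr1 !mulr1.
rewrite -mulr_sumr mulrCA -mulrA ler_wpM2l// sumrB sumr_const card_ffun !card_ord.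
rewrite -natr_sum -big_mkcond/= sum1dep_card card_inj_ffuns !card_ord.
rewrite mulrA ler_pdivlMr// mulrBl lerBlDl -!natrX -!natrM -natrD ler_nat.
exact: expn_le_ffact.
Qed.

(** With tilt [s = K * n / n ^+ v], each exponent is at most [s * C / p = K * C * rho], which
    [1 / 2] must dominate. The variance of a scaled edge variable is [(1 - p) / p <= 1 / p], and the
    squares of the edge sums total at most [C * M * n ^+ v], which gives the variance term in the
    exponent. *)
Lemma edge_tail (x : {ffun 'I_n -> 'I_c}) (sg K del : R) : `|sg| = 1 -> 0 < K ->
  let rho := n%:R / n%:R ^+ v / p in
  K * (M * (v ^ v)%:R) * rho <= 2^-1 ->
  \sum_(a : {ffun edges -> bool} |
     n%:R * (K * del) <= \sum_e (K * (n%:R / n%:R ^+ v)) *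
        (sg * edge_sum phi x e * ((if a e then p^-1 else 0) - 1)))
    config_weight a <=
  expR (n%:R * (2 * K ^+ 2 * (M * (v ^ v)%:R) * M * rho - K * del)).
Proof.
move=> sg1 K0 rho Krho.
have [p0 p1] := andP p01.
have n0R : 0 < n%:R :> R by rewrite ltr0n.
set C := M * (v ^ v)%:R in Krho *.
have C0 : 0 <= C by rewrite mulr_ge0.
have [s sdef] : exists s, s = K * (n%:R / n%:R ^+ v) by exists (K * (n%:R / n%:R ^+ v)).
rewrite -sdef; have s0 : 0 < s by rewrite sdef mulr_gt0// divr_gt0// exprn_gt0.
have sE : s / p = K * rho by rewrite sdef /rho -mulrA.
pose w (_ : edges) (b : bool) := if b then p else 1 - p.
pose g (e : edges) (b : bool) := s * (sg * edge_sum phi x e * ((if b then p^-1 else 0) - 1)).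
have := @product_chernoff R edges bool w g
  (fun e => 2 * (s ^+ 2 * (C * `|edge_sum phi x e|) / p)) (n%:R * (K * del)).
have pV : 1 <= p^-1 by rewrite -[leLHS]invr1 lef_pV2 ?posrE.
move=> H; apply: (le_trans (H _ _)).
- by move=> e b; rewrite /w; case: b; lra.
- move=> e; apply: (le_trans (mgf_le_expR_variance _ _ _ _)).
  + by case=> /=; lra.
  + by rewrite big_bool/= addrC subrK.
  + rewrite big_bool/= /g /=.
    by field; rewrite gt_eqF.
  + move=> b; rewrite /g (le_trans (ler_norm _))// normrM gtr0_norm// !normrM sg1 mul1r.
    have h1 : `|edge_sum phi x e| <= C by exact: edge_sum_le.
    have h2 : `|(if b then p^-1 else 0) - 1| <= p^-1.
      by case: b; rewrite ?sub0r ?normrN1// ger0_norm; lra.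
    apply: (@le_trans _ _ (s * (C * p^-1))).
      by rewrite ler_wpM2l ?(ltW s0)// ler_pM.
    by rewrite mulrCA mulrA [C * s]mulrC mulrAC sE mulrAC.
  rewrite ler_expR ler_wpM2l//.
  have -> : \sum_u w e u * g e u ^+ 2 =
      s ^+ 2 * (sg * edge_sum phi x e) ^+ 2 * ((1 - p) / p).
    by rewrite big_bool/= /g /=; field; rewrite gt_eqF.
  rewrite [(sg * _) ^+ 2]exprMn -(real_normK (num_real sg)) sg1 expr1n mul1r.
  rewrite -[leLHS]mulrA -[leRHS]mulrA ler_wpM2l ?sqr_ge0//.
  rewrite -(real_normK (num_real (edge_sum phi x e))) expr2.
  apply: ler_pM.
  + by rewrite mulr_ge0.
  + by rewrite divr_ge0//; lra.
  + by rewrite ler_wpM2r//; exact: edge_sum_le.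
  + by rewrite ler_pdivrMr// mulVf ?gt_eqF//; lra.
rewrite ler_expR mulrBr lerD2r.
rewrite -mulr_sumr -mulr_suml -!mulr_sumr.
apply: (@le_trans _ _ (2 * (s ^+ 2 * (C * (M * n%:R ^+ v)) / p))).
  rewrite ler_wpM2l// ler_wpM2r ?invr_ge0 ?(ltW p0)// ler_wpM2l ?sqr_ge0// ler_wpM2l//.
  exact: sum_edge_sum_le.
rewrite le_eqVlt; apply/orP; left; apply/eqP; rewrite sdef /rho; field.
by rewrite !gt_eqF// exprn_gt0.
Qed.

End edge_concentration.

Lemma scaled_edge_deviation (R : realType) (v n c : nat)
    (phi : {ffun 'I_v -> 'I_c} -> R) (y : edge v n -> R) (x : {ffun 'I_n -> 'I_c})
    (sg K : R) :
  \sum_e (K * (n%:R / n%:R ^+ v)) * (sg * edge_sum phi x e * (y e - 1)) =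
  n%:R * K * (sg * (tensor_avg (edge_tensor y) phi x -
     (n%:R ^+ v)^-1 * \sum_e edge_sum phi x e)).
Proof.
rewrite tensor_avg_edge -mulr_sumr -mulrBr -sumrB.
under eq_bigr => e _ do rewrite -mulrA.
rewrite -mulr_sumr.
under eq_bigr => e _ do rewrite mulrBr mulr1 mulrC.
set A := \sum_i _; move: A (n%:R ^+ v)^-1 => A B; ring.
Qed.

(** Union bound over colourings and signs: [c ^ n <= expR (c * n)] tails of size
    [expR (- (n * (c + 1)))] on each side leave [2 * expR (- n)]. *)
Lemma config_concentration (R : realType) (v c : nat)
    (phi : {ffun 'I_v -> 'I_c} -> R) (p : nat -> R) (del : R) :
  (forall n, (0 < n)%N -> 0 < p n <= 1) ->
  (n%:R : R) ^ (1 - v%:Z) / p n @[n --> \oo] --> (0 : R) -> 0 < del ->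
  \forall n \near \oo,
    \sum_(a : {ffun edge v n -> bool} |
       `[< ~ tensor_close phi del (config_tensor (p n) a) >])
      config_weight (p n) a <= 2 * expR (- n%:R).
Proof.
move=> p01 hp del0.
pose M := \sum_r `|phi r|.
have M0 : 0 <= M by exact: sumr_ge0.
have phiM r : `|phi r| <= M by rewrite /M (bigD1 r)//= lerDl sumr_ge0.
pose C := M * (v ^ v)%:R.
have C0 : 0 <= C by rewrite mulr_ge0.
pose del2 := del / 2.
have del20 : 0 < del2 by rewrite divr_gt0.
(* The gain is [K * del2 = 2 * (c + 1)]; half of it is reserved to absorb the variance term. *)
pose K := 2 * c.+1%:R / del2.
have K0 : 0 < K by rewrite divr_gt0// mulr_gt0.
have Kdel : K * del2 = 2 * c.+1%:R by rewrite /K divfK// gt_eqF.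
have KC0 : 0 <= K * C by rewrite mulr_ge0// ltW.
have KCM0 : 0 <= 2 * K ^+ 2 * C * M by rewrite mulr_ge0// mulr_ge0// mulr_ge0// sqr_ge0.
(* Below the first entry the exponents stay under 1/2, below the second the variance term stays
   under [c + 1]; the added 1 keeps the denominators positive. *)
pose eta := Num.min (2^-1 / (K * C + 1)) (c.+1%:R / (2 * K ^+ 2 * C * M + 1)).
have eta0 : 0 < eta by rewrite lt_min; apply/andP; split; rewrite divr_gt0// ltr_wpDl.
near=> n.
have n0 : (0 < n)%N by near: n; exact: nbhs_infty_ge.
have n0R : 0 < n%:R :> R by rewrite ltr0n.
have pn := p01 n n0.
have /andP[p0 p1] := pn.
pose rho := n%:R / n%:R ^+ v / p n.
have rho0 : 0 <= rho by rewrite divr_ge0 ?(ltW p0)// divr_ge0// exprn_ge0.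
have rhoeta : rho <= eta.
  have -> : rho = (n%:R : R) ^ (1 - v%:Z) / p n.
    by rewrite /rho expfzDr ?gt_eqF// expr1z -exprnN.
  have : `|0 - (n%:R : R) ^ (1 - v%:Z) / p n| < eta.
    by near: n; have /cvgrPdist_lt := hp; apply.
  by rewrite sub0r normrN => h; exact: le_trans (ler_norm _) (ltW h).
have bias : M * (v ^ 2)%:R / n%:R <= del2.
  rewrite ler_pdivrMr// [del2 * _]mulrC -ler_pdivrMr//.
  by near: n; exact: nbhs_infty_ger.
pose ev (sg : R) (x : {ffun 'I_n -> 'I_c}) (a : {ffun edge v n -> bool}) :=
  n%:R * (K * del2) <= \sum_e (K * (n%:R / n%:R ^+ v)) *
    (sg * edge_sum phi x e * ((if a e then (p n)^-1 else 0) - 1)).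
have tail x sg : `|sg| = 1 ->
    \sum_(a | ev sg x a) config_weight (p n) a <= expR (- (n%:R * c.+1%:R)).
  move=> sg1; have KCr : K * C * rho <= 2^-1.
    apply: (@le_trans _ _ ((K * C + 1) * eta)).
      by apply: ler_pM => //; lra.
    by rewrite mulrC -ler_pdivlMr ?ge_min ?lexx// ltr_wpDl.
  apply: (le_trans (@edge_tail _ _ _ _ phi M (p n) n0 M0 phiM pn x sg K del2 sg1 K0 KCr)).
  rewrite ler_expR -[- (n%:R * _)]mulrN ler_wpM2l// Kdel -/C.
  have : (2 * K ^+ 2 * C * M + 1) * eta <= c.+1%:R.
    by rewrite mulrC -ler_pdivlMr ?ge_min ?lexx ?orbT// ltr_wpDl.
  have : 2 * K ^+ 2 * C * M * rho <= (2 * K ^+ 2 * C * M + 1) * eta.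
    by apply: ler_pM => //; lra.
  rewrite -/rho; lra.
apply: (@le_trans _ _ (\sum_(x : {ffun 'I_n -> 'I_c})
    (expR (- (n%:R * c.+1%:R)) + expR (- (n%:R * c.+1%:R))))); last first.
  set E := expR _.
  have -> : \sum_(x : {ffun 'I_n -> 'I_c}) (E + E) = 2 * (c%:R ^+ n * E).
    rewrite sumr_const card_ffun !card_ord -natrX.
    by rewrite -[(E + E) *+ _]mulr_natl; ring.
  rewrite ler_wpM2l// /E; apply: (@le_trans _ _ (expR c%:R ^+ n * expR (- (n%:R * c.+1%:R)))).
    rewrite ler_wpM2r ?expR_ge0// lerXn2r ?nnegrE ?expR_ge0//.
    by apply: le_trans (expR_ge1Dx _); rewrite lerDr.
  by rewrite -expRM_natl -expRD ler_expR -natr1; lra.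
apply: (@le_trans _ _ (\sum_(x : {ffun 'I_n -> 'I_c})
    (\sum_(a | ev 1 x a) config_weight (p n) a +
     \sum_(a | ev (-1) x a) config_weight (p n) a))); last first.
  by apply: ler_sum => x _; apply: lerD; apply: tail; rewrite ?normrN1 ?normr1.
rewrite (eq_bigr (fun x => \sum_a ((if ev 1 x a then config_weight (p n) a else 0) +
    (if ev (-1) x a then config_weight (p n) a else 0)))); last first.
  by move=> x _; rewrite big_split/= -!big_mkcond.
rewrite exchange_big big_mkcond/=; apply: ler_sum => a _.
have w0 : 0 <= config_weight (p n) a by exact: config_weight_ge0.
case: ifPn => [/asboolP na|_]; last first.
  by apply: sumr_ge0 => x _; rewrite addr_ge0//; case: ifP.
have /existsNP[x /negP] := na; rewrite -ltNge => xdel.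
rewrite (bigD1 x)//= -[leLHS]addr0; apply: lerD; last first.
  by apply: sumr_ge0 => y _; rewrite addr_ge0//; case: ifP.
rewrite /ev !(scaled_edge_deviation phi (fun e => if a e then (p n)^-1 else 0)) mul1r mulN1r.
set D := tensor_avg _ _ _ - _.
(* The bias uses at most half of [del], so the random fluctuation exceeds the other half. *)
have : del2 < `|D|.
  have b := edge_average_bias n0 M0 phiM x.
  have := ler_distD ((n%:R ^+ v)^-1 * \sum_e edge_sum phi x e)
    (tensor_avg (config_tensor (p n) a) phi x) (mean_field phi (empirical x)).
  rewrite -/D; move: xdel b bias; rewrite /del2; lra.
have nK0 : 0 <= n%:R * K by rewrite mulr_ge0// ltW.
rewrite mulrA lter_normr => /orP[h|h].
  by rewrite (ler_wpM2l nK0 (ltW h)) lerDl; case: ifP.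
by rewrite (ler_wpM2l nK0 (ltW h)) lerDr; case: ifP.
Unshelve. all: by end_near. Qed.

(** * The law of the hypergraph tensor and conditioning on it *)

Lemma measurable_bigcup_finType d (T : measurableType d) (I : finType) (D : set I)
    (F : I -> set T) :
  (forall i, D i -> measurable (F i)) -> measurable (\bigcup_(i in D) F i).
Proof. by move=> mF; apply: fin_bigcup_measurable => //; exact: finite_finset. Qed.

Lemma measure_bigcup_finType d (T : measurableType d) (R : realType)
    (mu : {measure set T -> \bar R}) (I : finType) (D : set I) (F : I -> set T) :
  trivIset D F -> (forall i, D i -> measurable (F i)) ->
  mu (\bigcup_(i in D) F i) = (\sum_(i | `[< D i >]) mu (F i))%E.
Proof.
move=> tF mF; rewrite measure_fin_bigcup//; last exact: finite_finset.
have {1}-> : D = [set` enum (fun i => `[< D i >])].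
  by apply/seteqP; split=> i /=; rewrite mem_enum => /asboolP.
by rewrite -fsbig_seq ?enum_uniq// big_enum.
Qed.

Section hypergraph_law.
Context d (T : measurableType d) (R : realType) (P : probability T R).
Context (v n : nat) (p : R) (Q : T -> tensor R v n).
Hypothesis p01 : 0 < p <= 1.
Hypothesis QER : ER_hypergraph_tensor P p Q.
Local Notation edges := (edge v n).

Lemma measurable_tensor_entry i : measurable_fun setT (fun w => Q w i).
Proof.
have [xi [_ _ QE]] := QER.
rewrite (_ : (fun _ => _) = fun w =>
  if injectiveb i then xi [set i a | a : 'I_v]%SET w else 0); last exact/funext.
by case: injectiveb => //; exact: measurable_funP.
Qed.

Lemma measurable_tensor_set (B : {ffun 'I_v -> 'I_n} -> set R) :
  (forall i, measurable (B i)) -> measurable [set w | forall i, B i (Q w i)].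
Proof.
move=> mB; rewrite (_ : [set _ | _] = \bigcap_(i in setT) (fun w => Q w i) @^-1` B i).
  apply: fin_bigcap_measurable => // i _; rewrite -[X in measurable X]setTI.
  exact: measurable_tensor_entry.
by apply/seteqP; split=> w /= h i; [move=> _; exact: h|exact: h].
Qed.

Lemma tensor_levelE q : [set w | Q w = q] = [set w | forall i, [set q i] (Q w i)].
Proof. by apply/seteqP; split=> w /= h; [rewrite h|exact/funext]. Qed.

Lemma measurable_tensor_level q : measurable [set w | Q w = q].
Proof.
rewrite tensor_levelE; apply: (@measurable_tensor_set (fun i => [set q i])) => i.
exact: measurable_set1.
Qed.

(** Each event prescribes all edge variables. The events are disjoint because [p^-1] is not 0, and
    their weights sum to 1, so the remaining values of the edge variables form a null set. *)
Lemma config_events : exists Om : {ffun edges -> bool} -> set T,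
  [/\ forall a, measurable (Om a), forall a, P (Om a) = (config_weight p a)%:E,
      forall a w, Om a w -> Q w = config_tensor p a &
      P (\bigcup_(a in setT) Om a) = 1%E /\ trivIset setT Om].
Proof.
have [xi [xiP xiI QE]] := QER; have /andP[p0 p1] := p01.
pose y (a : {ffun edges -> bool}) (e : {set 'I_n}) : R :=
  if insub e is Some e' then (if a e' then p^-1 else 0) else 0.
have yE a (e : edges) : y a (val e) = if a e then p^-1 else 0 by rewrite /y valK.
pose Om a := [set w | forall e : {set 'I_n}, #|e| == v -> [set y a e] (xi e w)].
have mOm a : measurable (Om a).
  rewrite (_ : Om a = \bigcap_(e in [set e : {set 'I_n} | #|e| == v]) xi e @^-1` [set y a e])//.
  apply: fin_bigcap_measurable => [|e _]; first exact: finite_finset.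
  rewrite -[X in measurable X]setTI.
  by apply: (measurable_funP (xi e)) => //; exact: measurable_set1.
have POm a : P (Om a) = (config_weight p a)%:E.
  rewrite (xiI (fun e => [set y a e]))// (big_sub (fun e : {set 'I_n} => #|e| == v))/=.
  rewrite /config_weight -prodEFin; apply: eq_bigr => e _.
  have [xi1 xi0] := xiP (val e) (eqP (valP e)).
  by rewrite yE; case: (a e).
have tOm : trivIset setT Om.
  move=> a b _ _ [w [wa wb]]; apply/ffunP => e.
  have := wa (val e) (valP e); have := wb (val e) (valP e).
  rewrite /= !yE => ->; case: (a e); case: (b e) => // /eqP.
    by rewrite eq_sym invr_eq0 gt_eqF.
  by rewrite invr_eq0 gt_eqF.
exists Om; split=> //.
  move=> a w wa; apply/funext => i; rewrite QE /config_tensor /edge_tensor.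
  case: ifPn => // ii; have iv := injective_edge ii.
  by rewrite (wa _ iv) /y.
split=> //; rewrite measure_bigcup_finType//.
rewrite (eq_bigl predT) => [|a]; last by apply/asboolP.
rewrite (eq_bigr (fun a => (config_weight p a)%:E)) => [|a _]; last exact: POm.
by rewrite sumEFin sum_config_weight.
Qed.

Lemma tensor_prob_le (K : tensor R v n -> Prop) : measurable [set w | K (Q w)] ->
  (P [set w | K (Q w)] <=
   (\sum_(a | `[< K (config_tensor p a) >]) config_weight p a)%:E)%E.
Proof.
move=> mK; have [Om [mOm POm OmQ [P1 tOm]]] := config_events.
have mU : measurable (\bigcup_(a in setT) Om a) by apply: measurable_bigcup_finType.
have -> : (\sum_(a | `[< K (config_tensor p a) >]) config_weight p a)%:E =
    P (\bigcup_(a in [set a | K (config_tensor p a)]) Om a).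
  rewrite measure_bigcup_finType//; last by apply: sub_trivIset tOm.
  by rewrite -sumEFin; apply: eq_bigr => a _; exact/esym/POm.
apply: (@le_trans _ _ (P ((\bigcup_(a in [set a | K (config_tensor p a)]) Om a) `|`
    ~` (\bigcup_(a in setT) Om a)))).
  apply: le_measure; rewrite ?inE//.
    by apply: measurableU; [exact: measurable_bigcup_finType|exact: measurableC].
  move=> w /= Kw; have [[a _ aw]|] := pselect ((\bigcup_(a in setT) Om a) w).
    by left; exists a => //=; rewrite -(OmQ a w).
  by right.
have PU : (P (~` (\bigcup_(a in setT) Om a)) <= 0)%E.
  by rewrite probability_setC// P1 subee.
apply: (le_trans (measureU2 _ _ _)).
- exact: measurable_bigcup_finType.
- exact: measurableC.
- by rewrite -[leRHS]adde0; apply: leeD.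
Qed.

(** Tensor values outside the configurations are never atoms, so elementary conditioning on them
    takes a default value. *)
Lemma tensor_prob_off q : (forall a, q <> config_tensor p a) -> P [set w | Q w = q] = 0%E.
Proof.
move=> qa; apply/eqP; rewrite eq_le measure_ge0 andbT.
apply: (le_trans (@tensor_prob_le (fun q' => q' = q) (measurable_tensor_level q))).
by rewrite big1// => a /asboolP aq; case: (qa a).
Qed.

Lemma config_weight_le_prob a :
  ((config_weight p a)%:E <= P [set w | Q w = config_tensor p a])%E.
Proof.
have [Om [mOm POm OmQ _]] := config_events; rewrite -POm.
by apply: le_measure; rewrite ?inE//; [exact: measurable_tensor_level|exact: OmQ].
Qed.

(* Q is almost surely one of the configuration tensors, but its values on the
   exceptional null set are arbitrary. *)
Lemma measurable_tensor_pred (K : tensor R v n -> Prop) :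
  (forall q q', (forall a, q <> config_tensor p a) ->
     (forall a, q' <> config_tensor p a) -> K q -> K q') ->
  measurable [set w | K (Q w)].
Proof.
move=> Koff.
pose U1 := \bigcup_(a in [set a | K (config_tensor p a)]) [set w | Q w = config_tensor p a].
pose U2 := \bigcup_(a in setT) [set w | Q w = config_tensor p a].
have mU1 : measurable U1.
  by apply: measurable_bigcup_finType => a _; exact: measurable_tensor_level.
have mU2 : measurable U2.
  by apply: measurable_bigcup_finType => a _; exact: measurable_tensor_level.
have U2P w : ~ U2 w -> forall a, Q w <> config_tensor p a.
  by move=> wU a wa; apply: wU; exists a.
have [[w0 w0U Kw0]|noK] := pselect (exists2 w, ~ U2 w & K (Q w)).
  rewrite (_ : [set _ | _] = U1 `|` ~` U2).
    by apply: measurableU => //; exact: measurableC.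
  apply/seteqP; split=> w /=.
    move=> Kw; have [[a _ wa]|] := pselect (U2 w); last by right.
    by left; exists a => //=; rewrite -wa.
  move=> [[a /= Ka ->]//|wU].
  by apply: Koff Kw0; exact: U2P.
rewrite (_ : [set _ | _] = U1)//; apply/seteqP; split=> w /=.
  move=> Kw; have [[a _ wa]|wU] := pselect (U2 w); last by case: noK; exists w.
  by exists a => //=; rewrite -wa.
by move=> [a /= Ka ->].
Qed.

Lemma measurable_log_partition c (phi : {ffun 'I_v -> 'I_c} -> R) (mu : 'I_c -> R)
    (beta : R) : measurable_fun setT (fun w => log_partition phi mu beta (Q w)).
Proof.
apply: measurable_funM => //; apply: measurableT_comp; first exact: measurable_ln.
apply: measurable_sum => x; apply: measurable_funM => //.
apply: measurableT_comp; first exact: measurable_expR.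
apply: measurable_funM => //; apply: measurable_funM => //.
apply: measurable_sum => i; apply: measurable_funM => //.
exact: measurable_tensor_entry.
Qed.

(** Splitting by the finitely many values of [X], independence factors out the probability of the
    tensor value: conditioning freezes the tensor and leaves the product law of the colours. *)
Lemma colours_conditional_law c (phi : {ffun 'I_v -> 'I_c} -> R) (mu : 'I_c -> R)
    (X : T -> {ffun 'I_n -> 'I_c}) (F : set R) q :
  iid_colours P mu X -> colours_independent_of_tensor P X Q ->
  (0 < P [set w | Q w = q])%E ->
  fine (P ((fun w => tensor_avg (Q w) phi (X w)) @^-1` F `&` [set w | Q w = q])) /
    fine (P [set w | Q w = q]) =
  \sum_(x | `[< F (tensor_avg q phi x) >]) product_weight mu x.
Proof.
move=> Xiid Xind Pq.
have Pfin : P [set w | Q w = q] \is a fin_num.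
  by apply: fin_num_measure; exact: measurable_tensor_level.
rewrite (_ : _ `&` _ = \bigcup_(x in [set x | F (tensor_avg q phi x)])
    ([set w | X w = x] `&` [set w | Q w = q])); last first.
  apply/seteqP; split=> w /=.
    by move=> [Fw Qw]; exists (X w) => //=; rewrite -Qw.
  by move=> [x /= Fx [-> ->]].
rewrite measure_bigcup_finType; last 2 first.
- by move=> x y _ _ [w [[<- _] [<- _]]].
- move=> x _; apply: measurableI; last exact: measurable_tensor_level.
  by have [] := Xiid x.
rewrite (eq_bigr (fun x => (product_weight mu x * fine (P [set w | Q w = q]))%:E)).
  rewrite sumEFin /= -mulr_suml mulfK//.
  by rewrite gt_eqF// fine_gt0// Pq ltey_eq Pfin.
move=> x _; have [mx Px] := Xiid x.
rewrite EFinM fineK// -Px tensor_levelE; apply: (Xind x (fun i => [set q i])) => i.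
exact: measurable_set1.
Qed.

End hypergraph_law.

(** Transfers a deterministic statement about close tensors to a limit in probability. It is asked
    only at atoms of the tensor, where elementary conditioning is meaningful. *)
Lemma typical_tensor_event d (T : measurableType d) (R : realType) (P : probability T R)
    (v c : nat) (phi : {ffun 'I_v -> 'I_c} -> R) (p : nat -> R)
    (G : forall n, T -> tensor R v n) (K : forall n, tensor R v n -> Prop) (del : R) :
  (forall n, (0 < n)%N -> 0 < p n <= 1) ->
  (forall n, (0 < n)%N -> ER_hypergraph_tensor P (p n) (G n)) ->
  (n%:R : R) ^ (1 - v%:Z) / p n @[n --> \oo] --> (0 : R) ->
  0 < del ->
  (forall n, (0 < n)%N -> measurable [set w | K n (G n w)]) ->
  (\forall n \near \oo, forall q, tensor_close phi del q ->
     (0 < P [set w | G n w = q])%E -> K n q) ->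
  P [set w | K n (G n w)] @[n --> \oo] --> 1%E.
Proof.
move=> p01 GER hp del0 mK Kclose.
apply: (@squeeze_cvge _ _ _ _ (fun n => (1 - 2 * expR (- n%:R))%:E) _ (fun=> 1%E)).
- near=> n.
  have n0 : (0 < n)%N by near: n; exact: nbhs_infty_ge.
  have hK q : tensor_close phi del q -> (0 < P [set w | G n w = q])%E -> K n q.
    by move: q; near: n; exact: Kclose.
  rewrite probability_le1 ?andbT; last exact: mK.
  rewrite EFinB leeBlDl// -leeBlDr; last by apply: fin_num_measure; exact: mK.
  rewrite -probability_setC; last exact: mK.
  apply: (le_trans (tensor_prob_le (p01 n n0) (GER n n0)
    (K := fun q => ~ K n q) (measurableC (mK n n0)))).
  rewrite lee_fin.
  apply: (@le_trans _ _ (\sum_(a : {ffun edge v n -> bool} |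
       `[< ~ tensor_close phi del (config_tensor (p n) a) >])
      config_weight (p n) a)); last first.
    by near: n; exact: config_concentration.
  rewrite big_mkcond [leRHS]big_mkcond/=; apply: ler_sum => a _.
  have w0 := config_weight_ge0 (p01 n n0) a.
  case: ifPn => [/asboolP nK|_]; last by case: ifP.
  case: ifPn => // /asboolP/contrapT aclose.
  (* A close configuration outside [K] must have weight 0: a positive weight would make its tensor
     an atom, where [K] holds. *)
  rewrite leNgt; apply/negP => wa; apply: nK.
  apply: hK => //.
  by apply: lt_le_trans (config_weight_le_prob (p01 n n0) (GER n n0) a); rewrite lte_fin.
- apply: cvg_EFin; first exact: nearW.
  rewrite (_ : _ \o _ = fun n => 1 - 2 * expR (- n%:R)); last exact/funext.
  rewrite -[X in _ --> X]subr0 -[X in _ --> _ - X](mulr0 2).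
  apply: cvgB; first exact: cvg_cst.
  by apply: cvgM; [exact: cvg_cst|exact: cvgn_expR].
- exact: cvg_cst.
Unshelve. all: by end_near. Qed.

(** * The limit theorems *)

Theorem proposition2p5 (R : realType) (c v : nat) (hc : (2 <= c)%N)
    (hv : (2 <= v)%N)
    (mu : 'I_c -> R) (mu_gt0 : forall r, 0 < mu r)
    (mu_sum1 : \sum_(r < c) mu r = 1)
    (phi : {ffun 'I_v -> 'I_c} -> R)
    (d : measure_display) (T : measurableType d) (P : probability T R)
    (p : nat -> R) (p01 : forall n, (0 < n)%N -> 0 < p n <= 1)
    (G : forall n, T -> tensor R v n)
    (GER : forall n, (0 < n)%N -> ER_hypergraph_tensor P (p n) (G n))
    (hp : (n%:R : R) ^ (1 - v%:Z) / p n @[n --> \oo] --> (0 : R)) :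
  (forall X : forall n, T -> {ffun 'I_n -> 'I_c},
     (forall n, (0 < n)%N -> iid_colours P mu (X n)) ->
     (forall n, (0 < n)%N -> colours_independent_of_tensor P (X n) (G n)) ->
     conditional_LDP P G (fun n w => tensor_avg (G n w) phi (X n w))
       (rate_one phi mu)) /\
  (forall beta : R,
     let S := ereal_sup [set free_energy phi mu beta f |
                          f in @fractional_colourings R c] in
     cvg_in_probability P (fun n w => log_partition phi mu beta (G n w)) S /\
     exists2 f, @fractional_colourings R c f & free_energy phi mu beta f = S).
Proof.
have muP : prob_vector mu by split=> // r; exact: ltW.
split=> [X Xiid Xind|beta S].
  split; first exact: good_rate_one.
  move=> F mF eps eps0.
  have [del1 del10 upper] := ldp_upper_bound phi mu_gt0 F muP eps0.
  have [del2 del20 lower] := ldp_lower_bound phi mu_gt0 F muP eps0.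
  (* The elementary conditional probability as a function of the tensor value, so that the event of
     the LDP becomes a predicate [K] of the tensor. *)
  pose cond n (q : tensor R v n) : R :=
    fine (P ((fun w => tensor_avg (G n w) phi (X n w)) @^-1` F `&`
      [set w | G n w = q])) / fine (P [set w | G n w = q]).
  pose K n (q : tensor R v n) : Prop :=
    (- ereal_inf (rate_one phi mu @` interior F) - eps%:E <=
       (n%:R^-1)%:E * lne (cond n q)%:E)%E /\
    ((n%:R^-1)%:E * lne (cond n q)%:E <=
       - ereal_inf (rate_one phi mu @` closure F) + eps%:E)%E.
  apply: (@typical_tensor_event _ _ _ _ _ _ phi p G K (Num.min del1 del2)) => //.
  - by rewrite lt_min del10.
  - move=> n n0; apply: (measurable_tensor_pred (GER n n0) (K := K n)) => q q' qo q'o.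
    (* Off the configurations the denominator is 0 and the quotient returns 0, so [K] has one truth
       value there, as measurability requires. *)
    have c0 q1 : (forall a, q1 <> config_tensor (p n) a) -> cond n q1 = 0.
      by move=> q1o; rewrite /cond (tensor_prob_off (p01 n n0) (GER n n0) q1o) invr0 mulr0.
    by rewrite /K !c0.
  - near=> n => q qclose Pq.
    have n0 : (0 < n)%N by near: n; exact: nbhs_infty_ge.
    rewrite /K /cond (colours_conditional_law (GER n n0) phi F (Xiid n n0) (Xind n n0) Pq).
    split.
      move: q qclose {Pq}; near: n; apply: filterS lower => n h q qc.
      by apply: h => x; apply: le_trans (qc x) _; rewrite ge_min lexx orbT.
    move: q qclose {Pq}; near: n; apply: filterS upper => n h q qc.
    by apply: h => x; apply: le_trans (qc x) _; rewrite ge_min lexx.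
have [q [qP qmax Fq Sq]] := free_energy_attained phi mu_gt0 beta (ltnW hc).
split; last first.
  exists (fun r _ => q r); first exact: fractional_colouring_cst.
  by rewrite Fq -Sq.
rewrite /S Sq => eps eps0.
set s := beta * _ - _.
have [del del0 close] := log_partition_close mu_gt0 muP eps0 qP erefl qmax.
pose K n (Q : tensor R v n) : Prop := `|log_partition phi mu beta Q - s| < eps.
have mK n : (0 < n)%N -> measurable [set w | K n (G n w)].
  move=> n0; rewrite (_ : [set _ | _] = setT `&`
    (fun w => `|log_partition phi mu beta (G n w) - s|) @^-1` `]-oo, eps[%classic).
    apply: (_ : measurable_fun setT _) => //.
    apply: measurableT_comp => //; apply: measurable_funB => //.
    exact: (measurable_log_partition (GER n n0)).
  by rewrite setTI; apply/seteqP; split=> w; rewrite /K /= in_itv.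
have PK : P [set w | K n (G n w)] @[n --> \oo] --> 1%E.
  apply: (@typical_tensor_event _ _ _ _ _ _ phi p G K del) => //.
  by apply: filterS close => n h Q Qc _; exact: h.
have : (1 - P [set w | K n (G n w)])%E @[n --> \oo] --> (1 - 1)%E.
  by apply: cvgeB => //; exact: cvg_cst.
rewrite subee//; apply: cvg_trans; apply: near_eq_cvg; near=> n.
have n0 : (0 < n)%N by near: n; exact: nbhs_infty_ge.
rewrite -probability_setC; last exact: mK.
congr (P _); apply/seteqP; split=> w; rewrite /K /= lee_fin leNgt.
  by move/negP.
by move/negP.
Unshelve. all: by end_near. Qed.
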